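(* Let $(\Omega,\mathcal F_{t},\mathrm P|_{\mathcal F_{t}})$ be atomless with countably generated $\mathcal F_{t}$ for every $t>0$ (i.e. $t\in\,]0,T]$), and let $\mathcal Z$ be a dense subset of $\{Z\in L^{1}_{+}(\mu_{g})\mid Z(1)=0\}$ with respect to the $L^{1}(\mu_g)$-norm. If the distortion function $g$ is continuous and concave and $Y^{*}\in\mathcal X_{g}$, then for every $Z^{o}\in L^{1}[Y^{*},\mu_{g}]$, $$\sup_{\tau\in\mathcal T}\mathcal E^{g}(Y_{\tau})=\sup_{\tau\in\mathcal T}\ \inf_{Z\in L^{1}_{+}(\mu_{g}),\,Z(1)=0}\mathbb E\big[U^{g,Z}_{\tau}\big]=\inf_{Z\in L^{1}_{+}(\mu_{g}),\,Z(1)=0}\ \sup_{\tau\in\mathcal T}\mathbb E\big[U^{g,Z}_{\tau}\big]=\inf_{Z\in\mathcal L^{*}_{\mathcal Z}(\mu_{g},Z^{o})}\ \sup_{\tau\in\mathcal T}\mathbb E\big[U^{g,Z}_{\tau}\big],$$ where $\mathcal L^{*}_{\mathcal Z}(\mu_{g},Z^{o})=\{\mathbf 1_{]0,a]}\cdot Z^{o}+Z\mid Z\in\mathcal Z,\ a\in\,]0,1[\}$. In particular, one can always take $Z^{o}=Z^{*}$ in this representation.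
   Context: Setting. $0<T<\infty$; $(\Omega,\mathcal F,(\mathcal F_t)_{0\le t\le T},\mathrm P)$ is a filtered probability space with $(\Omega,\mathcal F,\mathrm P)$ atomless, the filtration is right-continuous, and $\mathcal F_0$ contains only sets of probability $0$ or $1$ as well as all the null sets of $\mathcal F$. $Y=(Y_t)_{t\in[0,T]}$ is a nonnegative, adapted, right-continuous process with bounded paths; $Y^*=\sup_{t\in[0,T]}Y_t$; $\mathcal T$ is the set of all stopping times $\tau\le T$ with respect to $(\mathcal F_t)$. A distortion function is a nondecreasing $g:[0,1]\to[0,1]$ with $g(0)=0,\ g(1)=1$. $F_X$ denotes the distribution function of $X$. For nonnegative $X$, $\mathcal E^g(X)=\int_0^\infty g(1-F_X(x))\,dx$. $\mathcal X_g$ is the set of random variables $X$ on $(\Omega,\mathcal F,\mathrm P)$ with $\int_0^\infty g(1-F_{|X|}(x))\,dx<\infty$. For continuous concave $g$, $\mu_g$ is the unique probability measure on the Borel sets of $]0,1]$ with $g'(x)=\int_{]x,1]}\frac1u\,\mu_g(du)$ for $x\in\,]0,1[$, where $g'$ is the right-sided derivative of $g$ on $]0,1[$. $L^1(\mu_g)$ is the space of $\mu_g$-integrable functions on $]0,1]$ (modulo $\mu_g$-a.s. equality), $L^1_+(\mu_g)$ its nonnegative members. For $Z\in L^1_+(\mu_g)$ and $\tau\in\mathcal T$: $U^{g,Z}_\tau=\int_{]0,1]}\big[\frac{(Y_\tau-Z(\alpha))^+}{\alpha}+Z(\alpha)\big]\mu_g(d\alpha)$. $L^1[Y^*,\mu_g]=\{Z\in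 L^1_+(\mu_g)\mid Z(1)=0,\ \mathbb E[\int_{]0,1]}\frac{(Y^*-Z(\alpha))^+}{\alpha}\mu_g(d\alpha)]<\infty\}$. $Z^*:\,]0,1]\to\mathbb R$ is given by $Z^*(\alpha)=F_{Y^*}^{\leftarrow}(1-\alpha)$ for $\alpha\in\,]0,1[$ and $Z^*(1)=0$, with $F_{Y^*}^{\leftarrow}$ the left-continuous quantile function of the distribution function of $Y^*$. *)

(* Defs.v *)
From HB Require Import structures.
From mathcomp Require Import all_boot all_order all_algebra.
From mathcomp Require Import all_classical all_reals all_analysis.

Set Implicit Arguments.
Unset Strict Implicit.
Unset Printing Implicit Defensive.

Import Order.TTheory GRing.Theory Num.Theory.
Import numFieldNormedType.Exports.

Local Open Scope classical_set_scope.
Local Open Scope ring_scope.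

Section filtered_space.
Context (R : realType) (d : measure_display) (Omega : measurableType d).
Context (P : probability Omega R).
Implicit Types (T : R) (F : R -> set (set Omega)) (Y : R -> Omega -> R).

(* [G] is a sub-sigma-algebra; the pieces are required to be in [G], so that
   this is atomlessness of the restriction of [P] to [G]. *)
Definition atomless_on (G : set (set Omega)) : Prop :=
  forall A, G A -> (0 < P A)%E ->
    exists B, [/\ G B, B `<=` A, (0 < P B)%E & (P B < P A)%E].

Definition countably_generated (G : set (set Omega)) : Prop :=
  exists C : set (set Omega), countable C /\ G = <<s C >>.

(* Time is a real number; only the values at times in [0, T] matter. *)
Definition filtration T F : Prop :=
  (forall t, t \in `[0, T] -> sigma_algebra setT (F t) /\ F t `<=` measurable) /\
  (forall s t, 0 <= s -> s <= t -> t <= T -> F s `<=` F t).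

Definition right_continuous_filtration T F : Prop :=
  forall t, t \in `[0, T[ -> F t = \bigcap_(s in `]t, T]) F s.

Definition trivial_at0 F : Prop :=
  (forall A, F 0 A -> P A = 0%E \/ P A = 1%E) /\
  (forall A, measurable A -> P A = 0%E -> F 0 A).

Definition nonneg_process T Y : Prop :=
  forall t w, t \in `[0, T] -> 0 <= Y t w.

Definition adapted T F Y : Prop :=
  forall t, t \in `[0, T] ->
    forall B : set R, measurable B -> F t (Y t @^-1` B).

Definition right_continuous_paths T Y : Prop :=
  forall w t, t \in `[0, T[ -> Y s w @[s --> t^'+] --> Y t w.

Definition bounded_paths T Y : Prop :=
  forall w, exists M : R, forall t, t \in `[0, T] -> `|Y t w| <= M.

Definition Ystar T Y (w : Omega) : R := sup [set Y t w | t in `[0, T]].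

Definition stopping_times T F : set (Omega -> R) :=
  [set tau | (forall w, tau w \in `[0, T]) /\
             (forall t, t \in `[0, T] -> F t [set w | tau w <= t])].

Definition stopped Y (tau : Omega -> R) (w : Omega) : R := Y (tau w) w.

(* The library's [cdf], for functions not bundled as random variables. *)
Definition dist_fun (X : Omega -> R) (x : R) : R :=
  fine (P [set w | X w <= x]).

(* Left-continuous quantile function, meaningful for [p] in ]0, 1[. *)
Definition quantile (X : Omega -> R) (p : R) : R :=
  inf [set x | p <= dist_fun X x].

End filtered_space.

Section distortion.
Context (R : realType).

Definition distortion (g : R -> R) : Prop :=
  [/\ (forall x, x \in `[0, 1] -> g x \in `[0, 1]),
      {in `[0, 1] &, {homo g : x y / x <= y}}, g 0 = 0 & g 1 = 1].

Definition concave_on01 (g : R -> R) : Prop :=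
  @convex_function R R^o `[0, 1] (fun x => - g x).

(* A Borel probability on ]0, 1], seen as one on R concentrated on ]0, 1].
   The difference quotient is over h > 0: its limit is the right-sided
   derivative of g. *)
Definition is_mu_g (g : R -> R) (mu : probability (measurableTypeR R) R) : Prop :=
  mu (`]0, 1]%classic : set R) = 1%E /\
  forall x : R, x \in `]0, 1[ ->
    ((g (x + h) - g x) / h)%:E @[h --> 0^'+]
      --> (\int[mu]_(u in `]x, 1%R]) ((u : R)^-1)%:E)%E.

(* Functions on ]0, 1] are represented by functions on R whose values outside
   ]0, 1] are irrelevant; a class modulo mu-a.e. equality is represented by its
   nonnegative members. *)
Definition L1plus (mu : probability (measurableTypeR R) R) : set (R -> R) :=
  [set Z | mu.-integrable `]0, 1] (EFin \o Z) /\
           (forall a, a \in `]0, 1] -> 0 <= Z a)].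

Definition L1plus0 (mu : probability (measurableTypeR R) R) : set (R -> R) :=
  [set Z | L1plus mu Z /\ Z 1 = 0].

Definition L1dense (mu : probability (measurableTypeR R) R)
    (D A : set (R -> R)) : Prop :=
  D `<=` A /\
  forall Z, A Z -> forall e : R, 0 < e ->
    exists2 W, D W & (\int[mu]_(a in `]0%R, 1%R]) `|(Z a - W a)%R|%:E < e%:E)%E.

Definition Lstar (D : set (R -> R)) (Zo : R -> R) : set (R -> R) :=
  [set W | exists Z a, [/\ D Z, a \in `]0, 1[ &
             W = (fun x => \1_(`]0, a] : set R) x * Zo x + Z x)]].

End distortion.

Section functionals.
Context (R : realType) (d : measure_display) (Omega : measurableType d).
Context (P : probability Omega R).
Local Open Scope ereal_scope.

(* E^g(X), for X nonnegative. *)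
Definition distorted_exp (g : R -> R) (X : Omega -> R) : \bar R :=
  \int[lebesgue_measure]_(x in `[0%R, +oo[) (g (1 - dist_fun P X x))%:E.

Definition Xspace (g : R -> R) : set (Omega -> R) :=
  [set X : Omega -> R | measurable_fun setT X /\
           distorted_exp g (fun w => `|X w|%R) < +oo].

(* U^{g,Z}_tau, as a function of the stopped variable y = Y_tau(w). *)
Definition Ufun (mu : probability (measurableTypeR R) R) (Z : R -> R) (y : R)
    : \bar R :=
  \int[mu]_(a in `]0%R, 1%R]) (Num.max (y - Z a) 0 / (a : R) + Z a)%:E.

Definition EU (mu : probability (measurableTypeR R) R) (Y : R -> Omega -> R)
    (tau : Omega -> R) (Z : R -> R) : \bar R :=
  \int[P]_w Ufun mu Z (stopped Y tau w).

Definition L1Y (T : R) (Y : R -> Omega -> R)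
    (mu : probability (measurableTypeR R) R) : set (R -> R) :=
  [set Z | L1plus0 mu Z /\
     \int[P]_w \int[mu]_(a in `]0%R, 1%R])
        (Num.max (Ystar T Y w - Z a) 0 / (a : R))%:E < +oo].

Definition Zstar (T : R) (Y : R -> Omega -> R) (a : R) : R :=
  if a == 1%R then 0%R else quantile P (Ystar T Y) (1 - a).

End functionals.

(* Main.v *)
(* Integrating the distortion identity g(p) = int min(p/a, 1) mu_g(da) over the
   levels x of p = P(X > x) gives E^g(X) = inf_Z E[U^{g,Z}], attained by the
   quantile function of X; this settles the inner infimum, and Z^*.

   For the exchange of sup and inf, E^g(Y_tau) = G(S_tau) is a concave functional
   of the tail S_tau(x) = P(Y_tau > x), and a dual variable Z amounts to a tangent
   of G.  If tau_0 is nearly optimal and the tails were a convex set, then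
   G(S_0 + t (S - S_0)) <= sup G bounds the tangent at a point of the segment, and
   one needs the tangent at S_0 itself.  Three devices replace compactness:
   - convexity: in the atomless sigma-algebra F_s there are events A_n of
     probability t with P(A_n & B) -> t P(B) for all B (independent events and
     Bessel's inequality); switching at time s > 0 between two stopping times
     along A_n, then letting n -> oo and s -> 0, with Fatou's lemma, shows that
     mixtures of tails do not exceed the supremum of a concave functional;
   - kinks of g: G is averaged over the dilations g(q^-j .), j <= N, with q close
     to 1; moving by the factor q shifts the levels by one, so that the errors
     telescope and are of relative size 1/N;
   - the tail of Y^* times a small k is added to all tails, which makes them
     comparable, so that a step t independent of the tails changes each of them
     at most by the factor q.
   The dual variables found for j <= N are averaged, by convexity in Z. *)

Require Import Defs.
From HB Require Import structures.
From mathcomp Require Import all_boot all_order all_algebra.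
From mathcomp Require Import all_classical all_reals all_analysis.
From mathcomp Require Import measurable_realfun measurable_fun_approximation.
From mathcomp Require Import lra.

Set Implicit Arguments.
Unset Strict Implicit.
Unset Printing Implicit Defensive.

Import Order.TTheory GRing.Theory Num.Theory.
Import numFieldNormedType.Exports.

Local Open Scope classical_set_scope.
Local Open Scope ring_scope.

(** * Mixing events in an atomless sigma-algebra *)

(** No optimal stopping time and no optimal dual variable is at hand, so the argument is
    quantitative and the order of the choices carries it. Mixing a nearly optimal tail with another
    one by a step [t] leaves the near-optimality error divided by [t]; hence [t] has to be the same
    for all tails. Adding [k] times the tail of $Y^*$ bounds the ratio of any two tails by
    [C = (1 + k) / k]. So [k] is chosen first, small enough that the added tail hardly raises the
    value; then [N], because the error left by the telescoping, of order [C], is divided by [N];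
    then [q], so close to 1 that [q ^ N.+1 <= 1 + k]; then [t]; and last the tail, optimal up to
    [t]. The switch waits for a positive time because atomlessness is available only there.

    The passage to a dense family is a separate matter: the weight $1/\alpha$ is unbounded near 0,
    so closeness in $L^1(\mu_g)$ controls the cost only away from 0, and near 0 the fixed $Z^o$
    supplies a finite cost for $Y^*$ itself. *)

Section real_probability.
Context (R : realType) (d : measure_display) (Omega : measurableType d).
Context (P : probability Omega R).

Definition pr (A : set Omega) : R := fine (P A).

Lemma prE A : measurable A -> P A = (pr A)%:E.
Proof. by move=> mA; rewrite fineK// fin_num_measure. Qed.

Lemma pr_ge0 A : 0 <= pr A.
Proof. exact: fine_ge0. Qed.

Lemma prT : pr setT = 1.
Proof. by rewrite /pr probability_setT. Qed.

Lemma pr0 : pr set0 = 0.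
Proof. by rewrite /pr measure0. Qed.

Lemma le_pr A B : measurable A -> measurable B -> A `<=` B -> pr A <= pr B.
Proof.
by move=> mA mB AB; rewrite -lee_fin -!prE// le_measure// inE.
Qed.

Lemma pr_le1 A : measurable A -> pr A <= 1.
Proof. by move=> mA; rewrite -prT le_pr. Qed.

Lemma prU A B : measurable A -> measurable B -> A `&` B = set0 ->
  pr (A `|` B) = pr A + pr B.
Proof.
move=> mA mB AB; rewrite /pr measureU// fineD// fin_num_measure//.
Qed.

Lemma prD A B : measurable A -> measurable B -> B `<=` A ->
  pr (A `\` B) = pr A - pr B.
Proof.
move=> mA mB BA; apply/eqP; rewrite -subr_eq opprK eq_sym; apply/eqP.
rewrite -prU//; last by rewrite setDKI.
  by rewrite setUC setDUK.
exact: measurableD.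
Qed.

Lemma prID A B : measurable A -> measurable B ->
  pr A = pr (A `&` B) + pr (A `\` B).
Proof.
move=> mA mB; rewrite -prU ?setUIDK//.
- exact: measurableI.
- exact: measurableD.
- by apply/seteqP; split => // x [[? ?] []].
Qed.

Lemma pr_bigcup_cvg (E : nat -> set Omega) :
  (forall n, measurable (E n)) -> nondecreasing_seq E ->
  pr (E n) @[n --> \oo] --> pr (\bigcup_n E n).
Proof.
move=> mE ndE; apply: fine_cvg; rewrite fineK.
  apply: nondecreasing_cvg_mu => //; exact: bigcup_measurable.
rewrite fin_num_measure//; exact: bigcup_measurable.
Qed.

(** The double sum is the expectation of the square of sum_i c_i 1_(C i). The index type is left
    free so that Bessel's inequality can treat the constant, the event and the sequence as one
    family. *)
Lemma gram_ge0 (I : Type) (s : seq I) (c : I -> R) (C : I -> set Omega) :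
  (forall i, measurable (C i)) ->
  0 <= \sum_(i <- s) \sum_(j <- s) c i * c j * pr (C i `&` C j).
Proof.
move=> mC.
have II i j : P.-integrable setT (fun w => (c i * c j * \1_(C i `&` C j) w)%:E).
  under eq_fun do rewrite EFinM.
  apply: integrableZl => //; apply: integrable_indic => //.
  exact: measurableI.
suff -> : \sum_(i <- s) \sum_(j <- s) c i * c j * pr (C i `&` C j) =
    fine (\int[P]_w ((\sum_(i <- s) c i * \1_(C i) w) ^+ 2)%:E).
  by apply: fine_ge0; apply: integral_ge0 => w _; rewrite lee_fin sqr_ge0.
under eq_integral do rewrite expr2 big_distrlr/=.
transitivity (fine (\int[P]_w (\sum_(i <- s) \sum_(j <- s)
    (c i * c j * \1_(C i `&` C j) w)%:E)))%E; last first.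
  congr fine; apply: eq_integral => w _.
  rewrite -sumEFin; apply: eq_bigr => i _; rewrite -sumEFin.
  apply: eq_bigr => j _.
  by rewrite indicI/=; congr EFin; lra.
rewrite integral_sum//; last by move=> i; exact: integrable_sum.
rewrite (eq_bigr (fun i => (\sum_(j <- s) c i * c j * pr (C i `&` C j))%:E)).
  by rewrite sumEFin.
move=> i _; rewrite integral_sum// -sumEFin; apply: eq_bigr => j _.
under eq_integral do rewrite EFinM.
rewrite integralZl//; last by apply: integrable_indic => //; exact: measurableI.
rewrite integral_indic ?setIT//; last exact: measurableI.
by rewrite [RHS]EFinM -prE//; exact: measurableI.
Qed.

End real_probability.
Section atomless.
Context (R : realType) (d : measure_display) (Omega : measurableType d).
Context (P : probability Omega R) (G : set (set Omega)).
Hypotheses (sG : sigma_algebra setT G) (GM : G `<=` measurable).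
Hypothesis atG : atomless_on P G.

Local Notation p := (pr P).

(** [G] is its own generated sigma-algebra, so closure properties of measurable sets transfer to [G]
    by rewriting. *)
Let mG : G.-sigma.-measurable = G.
Proof. exact: measurable_g_measurableTypeE. Qed.

Let GT : G setT.
Proof. by rewrite -mG; exact: measurableT. Qed.

Let GI A B : G A -> G B -> G (A `&` B).
Proof. by rewrite -mG; exact: measurableI. Qed.

Let GU A B : G A -> G B -> G (A `|` B).
Proof. by rewrite -mG; exact: measurableU. Qed.

Let GD A B : G A -> G B -> G (A `\` B).
Proof. by rewrite -mG; exact: measurableD. Qed.

Let GB (A : nat -> set Omega) : (forall n, G (A n)) -> G (\bigcup_n A n).
Proof. by move=> GA; rewrite -mG; apply: bigcup_measurable => n _; rewrite mG. Qed.

Let mGG A : G A -> measurable A.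
Proof. exact: GM. Qed.

(** Of a proper piece and its complement in [D], one has at most half the probability. *)
Lemma atomless_half D : G D -> 0 < p D ->
  exists B, [/\ G B, B `<=` D, 0 < p B & p B <= p D / 2].
Proof.
move=> GD_ D0.
have [|B [GB_ BD B0 BltD]] := atG GD_; first by rewrite prE ?lte_fin//; exact: mGG.
move: B0 BltD; rewrite !prE; try exact: mGG.
rewrite !lte_fin => B0 BltD.
have [h|h] := leP (p B) (p D / 2); first by exists B.
have GDB : G (D `\` B) by exact: GD.
have e : p (D `\` B) = p D - p B by apply: prD => //; exact: mGG.
exists (D `\` B); split => //; rewrite e; lra.
Qed.

Lemma atomless_small D e : G D -> 0 < p D -> 0 < e ->
  exists B, [/\ G B, B `<=` D, 0 < p B & p B <= e].
Proof.
move=> GD_ D0 e0.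
(* Repeated halving would give a geometric bound; the linear one is enough by the Archimedean
   property, and follows from n + 2 <= 2 (n + 1). *)
have H n : exists B, [/\ G B, B `<=` D, 0 < p B & p B * n.+1%:R <= p D].
  elim: n => [|n [B [GB_ BD B0 Bn]]]; first by exists D; split => //; rewrite mulr1.
  have [C [GC CB C0 CBn]] := atomless_half GB_ B0.
  exists C; split => //; first exact: subset_trans CB BD.
  apply: le_trans Bn.
  have : n.+2%:R <= 2 * n.+1%:R :> R by have := ler0n R n; rewrite -!natr1; lra.
  move=> n2; apply: (@le_trans _ _ (p C * (2 * n.+1%:R))).
    by rewrite ler_wpM2l// ltW.
  rewrite mulrA ler_wpM2r//; lra.
have [n] := H (Num.truncn (p D / e)).
case=> [GB_ BD B0 Bn]; exists n; split => //.
have /ltW := truncnS_gt (p D / e); rewrite ler_pdivrMr// => h.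
have := le_trans Bn h.
by rewrite mulrC ler_pM2l// ltr0Sn.
Qed.

(** The supremum of the admissible probabilities is not known to be attained, but some extension
    collects at least half of the possible gain. *)
Lemma atomless_greedy D c E : G D -> G E -> E `<=` D -> p E <= c ->
  exists E', [/\ G E', E `<=` E', E' `<=` D, p E' <= c &
    forall E'', G E'' -> E `<=` E'' -> E'' `<=` D -> p E'' <= c ->
      p E'' - p E <= 2 * (p E' - p E)].
Proof.
move=> GD_ GE ED Ec.
pose S := [set p E'' | E'' in [set E'' | [/\ G E'', E `<=` E'', E'' `<=` D & p E'' <= c]]].
have supS : has_sup S.
  split; first by exists (p E); exists E; split.
  by exists c => _ [E'' [_ _ _ ?] <-].
have [h|h] := leP (sup S) (p E).
  exists E; split => // E'' G'' h1 h2 h3.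
  have : p E'' <= sup S by apply: ub_le_sup; [exact: supS.2|exists E''].
  lra.
have [|_ [E' [G' h1 h2 h3] <-] h4] := @sup_adherent _ S ((sup S - p E) / 2) _ supS.
  by lra.
exists E'; split => // E'' G'' h1' h2' h3'.
have : p E'' <= sup S by apply: ub_le_sup; [exact: supS.2|exists E''].
lra.
Qed.

(** Greedy steps from the empty set reach the probability [c]: if the union [F] stayed below [c],
    some [B] disjoint from [F], of positive probability at most [c - p F], could be added at every
    stage, so each step would gain at least half of [p B] and the probabilities would be
    unbounded. *)
Lemma sierpinski D c : G D -> 0 <= c -> c <= p D ->
  exists B, [/\ G B, B `<=` D & p B = c].
Proof.
move=> GD_ c0 cD.
pose adm E := [/\ G E, E `<=` D & p E <= c].
(* Admissibility travels with the set, so that the recursion [E_] needs no separate invariant. *)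
have step (E : {E | adm E}) : {E' : {E | adm E} | sval E `<=` sval E' /\
    forall E'', adm E'' -> sval E `<=` E'' ->
      p E'' - p (sval E) <= 2 * (p (sval E') - p (sval E))}.
  case: E => E [GE ED Ec]; apply: cid.
  have [E' [G' h1 h2 h3 h4]] := atomless_greedy GD_ GE ED Ec.
  have aE' : adm E' by [].
  by exists (exist _ E' aE'); split => //= E'' [? ? ?] ?; exact: h4.
have adm0 : adm set0.
  by split => //; [rewrite -mG; exact: measurable0|rewrite pr0].
pose E_ := fix E_ n := if n is m.+1 then sval (step (E_ m)) else exist _ set0 adm0.
pose E n := sval (E_ n).
have aE n : adm (E n) := svalP (E_ n).
have GE n : G (E n) by have [] := aE n.
have ndE : nondecreasing_seq E.
  by apply/nondecreasing_seqP => n; apply/subsetPset; exact: (svalP (step (E_ n))).1.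
have gr n E'' : adm E'' -> E n `<=` E'' -> p E'' - p (E n) <= 2 * (p (E n.+1) - p (E n)).
  by move=> a s; exact: (svalP (step (E_ n))).2.
pose F := \bigcup_n E n.
have GF : G F by exact: GB.
have FD : F `<=` D by move=> w [n _]; have [_ + _] := aE n; exact.
have cvgF : p (E n) @[n --> \oo] --> p F.
  by apply: pr_bigcup_cvg => // n; exact: mGG.
have Fc : p F <= c.
  rewrite -(cvg_lim _ cvgF)//; apply: limr_le; first exact: cvgP cvgF.
  by near=> n; have [] := aE n.
have [Feq|Fne] := eqVneq (p F) c; first by exists F.
have Flt : p F < c by rewrite lt_neqAle Fne.
have GDF : G (D `\` F) by exact: GD.
have DF0 : 0 < p (D `\` F) by rewrite prD//; [lra|exact: mGG|exact: mGG].
have cF : 0 < c - p F by lra.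
have [B [GB_ BD B0 Bc]] := atomless_small GDF DF0 cF.
have EF n : E n `<=` F by move=> w ?; exists n.
have pEB n : p (E n `|` B) = p (E n) + p B.
  apply: prU; [exact: mGG|exact: mGG|].
  by apply/seteqP; split => // w [/EF Fw /BD []].
have inc n : p B <= 2 * (p (E n.+1) - p (E n)).
  have -> : p B = p (E n `|` B) - p (E n) by rewrite pEB; lra.
  apply: gr; last exact: subsetUl.
  split; [exact: GU| |].
    by move=> w [/EF /FD //|/BD []].
  rewrite pEB; have : p (E n) <= p F by apply: le_pr; [exact: mGG|exact: mGG|exact: EF].
  lra.
have lin n : n%:R * p B <= 2 * p (E n).
  elim: n => [|n ih]; first by rewrite mul0r mulr_ge0// pr_ge0.
  have := inc n; rewrite -natr1 mulrDl mul1r; lra.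
exfalso.
have /= := truncnS_gt (2 / p B); set n := Num.truncn _.
rewrite ltr_pdivrMr// => h.
have := lin n.+1; have : p (E n.+1) <= 1 by apply: pr_le1; exact: mGG.
lra.
Unshelve. all: by end_near. Qed.

(** [D] is refined by one event of the list at a time: the union of events of proportion [t] inside
    and outside [E] has proportion [t] in each of the two parts. *)
Lemma independent_subset (t : R) (L : seq (set Omega)) D : 0 <= t <= 1 -> G D ->
  (forall E, List.In E L -> G E) ->
  exists A, [/\ G A, A `<=` D, p A = t * p D &
    forall E, List.In E L -> p (A `&` E) = t * p (D `&` E)].
Proof.
move=> t01; elim: L D => [|E L IH] D GD_ GL.
  have := t01 => /andP[t0 t1].
  have [||B [? ? ?]] := @sierpinski D (t * p D) GD_; last by exists B.
  - by rewrite mulr_ge0// pr_ge0.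
  - by rewrite ler_piMl// pr_ge0.
have GE : G E by apply: GL; left.
have GL' F : List.In F L -> G F by move=> FL; apply: GL; right.
have [A1 [GA1 A1D pA1 A1L]] := IH (D `&` E) (GI GD_ GE) GL'.
have [A2 [GA2 A2D pA2 A2L]] := IH (D `\` E) (GD GD_ GE) GL'.
have A12 : A1 `&` A2 = set0.
  by apply/seteqP; split => // w [/A1D [_ ?] /A2D [_ ?]].
have pD : p D = p (D `&` E) + p (D `\` E) by apply: prID; exact: mGG.
exists (A1 `|` A2); split.
- exact: GU.
- by move=> w [/A1D []|/A2D []].
- by rewrite prU ?pA1 ?pA2 ?pD; [lra|exact: mGG|exact: mGG|].
- move=> F [<-|FL].
    rewrite setIUl [A2 `&` _](_ : _ = set0) ?setU0; last first.
      by apply/seteqP; split => // w [/A2D []].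
    by rewrite (setIidl (B := E)) ?pA1// => w /A1D [].
  have GF := GL' _ FL.
  rewrite setIUl prU; [|by apply: mGG; exact: GI|by apply: mGG; exact: GI|].
    rewrite A1L// A2L//.
    rewrite (@prID _ _ _ P (D `&` F) E); [|by apply: mGG; exact: GI|exact: mGG].
    rewrite -mulrDr; congr (_ * (p _ + p _)).
      by rewrite setIAC.
    by rewrite !setDE setIAC.
  by apply/seteqP; split => // w [[/A1D [_ ?] _] [/A2D [_ ?] _]].
Qed.

(** Each new event is independent of the finitely many earlier ones; pairwise independence is all
    that orthogonality in Bessel's inequality requires. *)
Lemma independent_sequence (t : R) : 0 <= t <= 1 ->
  exists A : nat -> set Omega, [/\ forall n, G (A n), forall n, p (A n) = t &
    forall m n, m != n -> p (A m `&` A n) = t ^+ 2].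
Proof.
move=> t01.
pose good (L : seq (set Omega)) := forall E, List.In E L -> G E.
have step (L : {L | good L}) : {A | G A /\ p A = t /\
    forall E, List.In E (sval L) -> p (A `&` E) = t * p E}.
  apply: cid; case: L => L gL.
  have [A [GA _ pA AL]] := independent_subset t01 GT gL.
  exists A; split=> //; split; first by rewrite pA prT mulr1.
  by move=> E EL; rewrite AL// setTI.
have gcons (L : {L | good L}) : good (sval (step L) :: sval L).
  move=> E [<-|EL]; first exact: (svalP (step L)).1.
  exact: (svalP L).
have good0 : good [::] by [].
pose L_ := fix L_ n : {L | good L} :=
  if n is m.+1 then exist _ _ (gcons (L_ m)) else exist _ _ good0.
pose A n := sval (step (L_ n)).
have AL m n : (m < n)%N -> List.In (A m) (sval (L_ n)).
  elim: n => // n ih; rewrite ltnS leq_eqVlt => /predU1P[->|mn]; first by left.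
  by right; exact: ih.
have pA n : p (A n) = t := (svalP (step (L_ n))).2.1.
have lt m n : (m < n)%N -> p (A n `&` A m) = t ^+ 2.
  by move=> mn; rewrite (svalP (step (L_ n))).2.2 ?pA//; exact: AL.
exists A; split => //.
  by move=> n; exact: (svalP (step (L_ n))).1.
move=> m n; rewrite neq_ltn => /orP[mn|nm]; last exact: lt.
by rewrite setIC lt.
Qed.

(* Bessel's inequality for the orthogonal functions 1_(A n) - t. *)
Lemma bessel (t : R) (A : nat -> set Omega) B : 0 <= t <= 1 ->
  (forall n, G (A n)) -> (forall n, p (A n) = t) ->
  (forall m n, m != n -> p (A m `&` A n) = t ^+ 2) -> measurable B ->
  forall N, \sum_(n < N) (p (A n `&` B) - t * p B) ^+ 2 <= 1.
Proof.
move=> /andP[t0 t1] GA pA pAA mB N.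
pose c (n : nat) := p (A n `&` B) - t * p B.
pose s := \sum_(n < N) c n.
pose q := \sum_(n < N) c n ^+ 2.
(* Together with the coefficients [x] this family describes 1_B - sum_n c_n (1_(A n) - t): [None]
   stands for the constant and [Some None] for [B]. *)
pose C (i : option (option nat)) := match i with
  None => setT | Some None => B | Some (Some n) => A n end.
pose x (i : option (option nat)) := match i with
  None => t * s | Some None => 1 | Some (Some n) => - c n end.
set l : seq (option (option nat)) :=
  None :: Some None :: [seq Some (Some (val n)) | n <- enum 'I_N].
have mC i : measurable (C i) by case: i => [[n|]|]//=; exact: mGG.
have := @gram_ge0 _ _ _ P _ l x C mC.
have lE f : \sum_(j <- l) f j = f None + (f (Some None) +
    \sum_(n < N) f (Some (Some (val n)))) :> R.
  by rewrite /l !big_cons big_map big_enum.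
rewrite (eq_bigr _ (fun i _ => lE _)) lE /= !setTI !setIT setIid prT.
have eAB : \sum_(n < N) c n * p (A n `&` B) = q + t * p B * s.
  rewrite /q /s mulr_sumr -big_split/=; apply: eq_bigr => n _.
  by rewrite /c; lra.
have -> : \sum_(n < N) t * s * - c n * p (setT `&` A n) = - (t ^+ 2 * s ^+ 2).
  rewrite (eq_bigr (fun n : 'I_N => - (t ^+ 2 * s) * c n)).
    by rewrite -mulr_sumr -/s; lra.
  by move=> n _; rewrite setTI pA; lra.
have -> : \sum_(n < N) 1 * - c n * p (B `&` A n) = - (q + t * p B * s).
  rewrite -eAB -sumrN; apply: eq_bigr => n _.
  by rewrite setIC; lra.
have -> : \sum_(i < N) (- c i * (t * s) * p (A i `&` setT) +
     (- c i * 1 * p (A i `&` B) +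
      \sum_(j < N) - c i * - c j * p (A i `&` A j))) =
   - (t ^+ 2 * s ^+ 2) + (- (q + t * p B * s) + (t ^+ 2 * s ^+ 2 + (t - t ^+ 2) * q)).
  rewrite -eAB !big_split/=; congr (_ + _).
    rewrite (eq_bigr (fun n : 'I_N => - (t ^+ 2 * s) * c n)).
      by rewrite -mulr_sumr -/s; lra.
    by move=> n _; rewrite setIT pA; lra.
  congr (_ + _).
    by rewrite -sumrN; apply: eq_bigr => n _; lra.
  rewrite (eq_bigr (fun n : 'I_N => t ^+ 2 * s * c n + (t - t ^+ 2) * c n ^+ 2)).
    by rewrite big_split/= -!mulr_sumr -/s -/q; lra.
  move=> n _; rewrite (bigD1 n)//= setIid pA.
  rewrite (eq_bigr (fun m : 'I_N => t ^+ 2 * c n * c m)); last first.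
    by move=> m mn; rewrite pAA; [lra|rewrite eq_sym].
  rewrite -mulr_sumr (_ : s = c n + \sum_(m < N | m != n) c m); last by rewrite /s (bigD1 n).
  by lra.
have pB1 := pr_le1 P mB.
have pB0 := pr_ge0 P B.
have q0 : 0 <= q by apply: sumr_ge0 => n _; exact: sqr_ge0.
(* The Gram sum amounts to [p B - 2 q + (t - t ^ 2) q], and [t - t ^ 2 <= 1], whence [q <= p B]. *)
rewrite -/q; nra.
Qed.

(** Square-summable covariances tend to 0. It matters that [B] need not belong to [G]: stopped
    values become known only after the time at which [A n] is decided. *)
Lemma mixing_sequence (t : R) : 0 <= t <= 1 ->
  exists A : nat -> set Omega, (forall n, G (A n)) /\
    forall B, measurable B -> p (A n `&` B) @[n --> \oo] --> t * p B.
Proof.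
move=> t01; have [A [GA pA pAA]] := independent_sequence t01.
exists A; split => // B mB.
pose c n := p (A n `&` B) - t * p B.
have nd : nondecreasing_seq (series (fun n => c n ^+ 2)).
  apply/nondecreasing_seqP => n.
  by rewrite !seriesEnat/= big_nat_recr//= lerDl sqr_ge0.
have /cvg_series_cvg_0 c20 : cvgn (series (fun n => c n ^+ 2)).
  apply: nondecreasing_is_cvgn => //; exists 1 => _ [n _ <-].
  by rewrite seriesEnat/= big_mkord; exact: bessel.
apply/cvgrPdist_lt => e e0.
have e20 : 0 < e ^+ 2 by exact: exprn_gt0.
move/cvgrPdist_lt : c20 => /(_ _ e20); apply: filterS => n.
rewrite sub0r normrN ger0_norm ?sqr_ge0// distrC -/(c n) => cn.
by rewrite -(ltr_pXn2r (n := 2))// ?nnegrE ?(ltW e0)// -normrX ger0_norm ?sqr_ge0.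
Qed.

End atomless.
(** * Tangents of min (s / a) 1 *)

Section truncated_slope.
Context (R : realType).
Implicit Types (a s b t q C : R).

(* [tmin a] is the extreme concave function s |-> min (s / a) 1, [slope a] its
   left derivative, and [tang a p] its tangent at p. *)
Definition tmin a s : R := Num.min (s / a) 1.
Definition slope a s : R := if s <= a then a^-1 else 0.
Definition tang a p b : R := if p <= a then b / a else 1.

Lemma slope_ge0 a s : 0 < a -> 0 <= slope a s.
Proof. by move=> a0; rewrite /slope; case: ifP => // _; rewrite invr_ge0 ltW. Qed.

Lemma le_slope a x y : 0 < a -> x <= y -> slope a y <= slope a x.
Proof.
move=> a0 xy; rewrite {1}/slope; case: ifPn => [ya|_]; last exact: slope_ge0.
by rewrite /slope (le_trans xy ya).
Qed.

Lemma tmin_tang a x : 0 < a -> tmin a x = tang a x x.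
Proof.
move=> a0; rewrite /tmin /tang minEle ler_pdivrMr// mul1r.
by case: ifP.
Qed.

Lemma tang_slope a p b : 0 < a -> tang a p b = tmin a p + slope a p * (b - p).
Proof.
move=> a0; rewrite tmin_tang// /tang /slope; case: ifP => _; last by rewrite mul0r addr0.
by rewrite mulrBr ![a^-1 * _]mulrC addrC subrK.
Qed.

Lemma tmin_le_tang a p x : 0 < a -> tmin a x <= tang a p x.
Proof.
by move=> a0; rewrite /tmin /tang; case: ifP => _; rewrite ge_min lexx ?orbT.
Qed.

Lemma tmin_ge0 a s : 0 < a -> 0 <= s -> 0 <= tmin a s.
Proof. by move=> a0 s0; rewrite le_min ler01 andbT divr_ge0// ltW. Qed.

Lemma tang_ge0 a p b : 0 < a -> 0 <= b -> 0 <= tang a p b.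
Proof. by move=> a0 b0; rewrite /tang; case: ifP => // _; rewrite divr_ge0// ltW. Qed.

Lemma le_tmin a : 0 < a -> {homo tmin a : x y / x <= y}.
Proof.
move=> a0 x y xy; rewrite le_min ge_min ler_pM2r ?invr_gt0// xy/=.
by rewrite ge_min lexx orbT.
Qed.

Lemma slope_mul_le a x : 0 < a -> 0 <= x -> slope a x * x <= tmin a x.
Proof.
move=> a0 x0; rewrite tmin_tang// /tang /slope; case: ifP => _; last by rewrite mul0r.
by rewrite mulrC.
Qed.

Lemma tmin_lipschitz a x y : 0 < a -> tmin a x <= tmin a y + a^-1 * `|x - y|.
Proof.
move=> a0; apply: (le_trans (tmin_le_tang y x a0)); rewrite tang_slope// lerD2l.
apply: (@le_trans _ _ (slope a y * `|x - y|)).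
  by rewrite ler_wpM2l ?slope_ge0// ler_norm.
by rewrite ler_wpM2r// /slope; case: ifP => // _; rewrite invr_ge0 ltW.
Qed.

Lemma tmin_subadd a x y : 0 < a -> 0 <= x -> 0 <= y ->
  tmin a (x + y) <= tmin a x + tmin a y.
Proof.
move=> a0 x0 y0; have [xa|xa] := leP x a; last first.
  rewrite {2}/tmin (_ : Num.min (x / a) 1 = 1); last first.
    by apply/min_idPr; rewrite ler_pdivlMr// mul1r ltW.
  apply: le_trans (_ : 1 <= _); first by rewrite ge_min lexx orbT.
  by rewrite lerDl tmin_ge0.
have [ya|ya] := leP y a; last first.
  rewrite {3}/tmin (_ : Num.min (y / a) 1 = 1); last first.
    by apply/min_idPr; rewrite ler_pdivlMr// mul1r ltW.
  apply: le_trans (_ : 1 <= _); first by rewrite ge_min lexx orbT.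
  by rewrite lerDr tmin_ge0.
rewrite (tmin_tang x)// (tmin_tang y)// /tang xa ya -mulrDl.
by rewrite ge_min lexx.
Qed.

Lemma tmin_homog_le a x c : 0 < a -> 0 <= x -> 1 <= c -> tmin a (c * x) <= c * tmin a x.
Proof.
move=> a0 x0 c1; have c0 : 0 <= c by apply: le_trans c1.
apply: (le_trans (tmin_le_tang x (c * x) a0)); rewrite tmin_tang// /tang.
by case: ifP => _; rewrite ?mulr1// mulrA.
Qed.

(** Applied with a power of the dilation factor for [q] and with [p] the undilated value divided by
    it, so that [s - q * p] is a plain difference of values. On the linear branch the claim reduces
    to [b <= s], on the flat one to [1 <= q]. *)
Lemma tang_scale_le a p q s b : 0 < a -> 1 <= q -> b <= s ->
  tang a p b <= q * tmin a p + slope a p * (s - q * p).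
Proof.
move=> a0 q1 bs; rewrite tmin_tang// /tang /slope; case: ifP => _.
  rewrite [_^-1 * _]mulrC mulrA -mulrDl ler_pM2r ?invr_gt0//; lra.
by rewrite mul0r addr0 mulr1.
Qed.

(* Evaluating a tangent at s / q ^ j instead of (s + t (s' - s)) / q ^ j costs a
   difference of two slopes; as moving from s to s + t (s' - s) shifts the level
   j by at most one, these differences telescope over the levels. *)
Lemma tang_telescope a (N : nat) s s' b t q C : 0 < a ->
  0 <= s -> 0 <= s' -> s' <= C * s -> 1 <= C -> b <= s' ->
  0 <= t -> 1 <= q -> t * (C - 1) <= q - 1 -> 1 <= (1 - t) * q ->
  t * (\sum_(j < N) tang a (s / q ^+ j.+1) b) +
    \sum_(j < N) q ^+ j.+1 * tmin a (s / q ^+ j.+1) <=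
  t * (\sum_(j < N) q ^+ j.+1 * tmin a (s / q ^+ j.+1)) +
    \sum_(j < N) q ^+ j.+1 * tmin a ((s + t * (s' - s)) / q ^+ j.+1) +
    t * (C * q ^+ N.+1 * tmin a (s / q ^+ N.+1)).
Proof.
move=> a0 s0 s'0 s'C C1 bs' t0 q1 tq tq'.
set st := s + t * (s' - s).
have q0 : 0 < q by lra.
have qj0 j : 0 < q ^+ j by rewrite exprn_gt0.
have qj1 j : 1 <= q ^+ j by rewrite exprn_ege1.
pose sc j := s / q ^+ j.
have scE j : q ^+ j * sc j = s by rewrite /sc mulrC divfK// gt_eqF.
have sc0 j : 0 <= sc j by rewrite divr_ge0// ltW.
(* This bound and the next say that [s] and [st] differ by a factor of at most [q], that is, by at
   most one level. *)
have st_le : st <= q * s.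
  rewrite /st; have : t * (s' - s) <= t * ((C - 1) * s).
    by rewrite ler_wpM2l//; lra.
  have : t * (C - 1) * s <= (q - 1) * s by rewrite ler_wpM2r.
  lra.
have st_ge : s <= q * st.
  have : 1 * s <= (1 - t) * q * s by rewrite ler_wpM2r.
  have : 0 <= q * (t * s') by rewrite !mulr_ge0// ltW.
  rewrite /st; lra.
pose D j := slope a (sc j).
pose E j := (D j.+1 - slope a (st / q ^+ j.+1)) * (s' - s).
(* [h1] bounds the tangent taken at [s / q ^ j.+1], [h2] uses the tangent at the moved point
   [st / q ^ j.+1]; [E j] is the mismatch of the two slopes. *)
have step j : t * tang a (sc j.+1) b + q ^+ j.+1 * tmin a (sc j.+1) <=
    t * (q ^+ j.+1 * tmin a (sc j.+1)) + q ^+ j.+1 * tmin a (st / q ^+ j.+1) + t * E j.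
  have h1 : t * tang a (sc j.+1) b <=
      t * (q ^+ j.+1 * tmin a (sc j.+1) + D j.+1 * (s' - s)).
    rewrite ler_wpM2l//; have := @tang_scale_le a (sc j.+1) _ _ _ a0 (qj1 j.+1) bs'.
    by rewrite scE.
  have h2 : q ^+ j.+1 * tmin a (sc j.+1) <= q ^+ j.+1 * tmin a (st / q ^+ j.+1) +
      slope a (st / q ^+ j.+1) * (s - st).
    have := tmin_le_tang (st / q ^+ j.+1) (sc j.+1) a0.
    rewrite tang_slope// -(ler_pM2l (qj0 j.+1)) => /le_trans; apply.
    rewrite mulrDr lerD2l mulrCA mulrBr scE.
    by rewrite [q ^+ _ * (st / _)]mulrC divfK// gt_eqF.
  by rewrite /E /st in h1 h2 *; lra.
have sumE : \sum_(j < N) E j <= C * q ^+ N.+1 * tmin a (sc N.+1).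
  have bnd : slope a (sc N.+1) * (C * s) <= C * q ^+ N.+1 * tmin a (sc N.+1).
    have := slope_mul_le a0 (sc0 N.+1).
    rewrite -(ler_pM2l (qj0 N.+1)) mulrCA scE => h.
    rewrite -mulrA [leLHS]mulrCA ler_wpM2l//; lra.
  apply: le_trans bnd.
  have Cs : s <= C * s by rewrite ler_peMl.
  have D0 j : 0 <= D j by exact: slope_ge0.
  (* The sign of [s' - s] decides whether the slope at the moved point is compared with that of the
     level below or of the level above. Either way the sum telescopes, and the surviving end term is
     at most the one at level N + 1. *)
  have [ss'|s's] := leP s s'.
    apply: (@le_trans _ _ (\sum_(0 <= j < N) (D j.+1 - D j) * (s' - s))).
      rewrite big_mkord; apply: ler_sum => j _.
      rewrite ler_wpM2r ?subr_ge0// lerD2l lerN2 le_slope//.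
      rewrite /sc ler_pdivrMr// exprS mulrCA divfK ?gt_eqF//.
    rewrite -mulr_suml telescope_sumr//.
    apply: (@le_trans _ _ (D N * s')).
      have := D0 0%N; have := D0 N; nra.
    apply: (@le_trans _ _ (D N * (C * s))); first exact: ler_wpM2l.
    rewrite ler_wpM2r ?mulr_ge0//; first lra.
    apply: le_slope => //; rewrite /sc ler_wpM2l// lef_pV2 ?posrE//.
    by rewrite exprS ler_peMl// ltW.
  apply: (@le_trans _ _ (\sum_(0 <= j < N) (D j.+2 - D j.+1) * (s - s'))).
    rewrite big_mkord; apply: ler_sum => j _.
    rewrite (_ : E j = (slope a (st / q ^+ j.+1) - D j.+1) * (s - s')); last by rewrite /E; lra.
    have ss0 : 0 <= s - s' by lra.
    rewrite ler_wpM2r// lerD2r le_slope//.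
    rewrite /sc exprS invfM mulrA ler_pM2r ?invr_gt0// ler_pdivrMr//.
    by rewrite mulrC.
  rewrite -mulr_suml (telescope_sumr (fun j => D j.+1))//.
  apply: (@le_trans _ _ (D N.+1 * s)); last by rewrite ler_wpM2l.
  have := D0 1%N; have := D0 N.+1; nra.
have : \sum_(j < N) (t * tang a (sc j.+1) b + q ^+ j.+1 * tmin a (sc j.+1)) <=
  \sum_(j < N) (t * (q ^+ j.+1 * tmin a (sc j.+1)) + q ^+ j.+1 * tmin a (st / q ^+ j.+1) + t * E j).
  by apply: ler_sum => j _; exact: step.
rewrite !big_split/= -!mulr_sumr => /le_trans; apply.
by rewrite lerD2l ler_wpM2l.
Qed.

End truncated_slope.
(** * Integrals over levels *)

(** Preimages of rays under a monotone function are intervals. *)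
Lemma measurable_fun_nonincreasing_itv (R : realType) (i : interval R) (f : R -> R) :
  (forall x y, x \in i -> y \in i -> x <= y -> f y <= f x) ->
  measurable_fun ([set` i] : set (measurableTypeR R)) f.
Proof.
move=> fi; apply: (measurability (@RGenCInfty.G R)) => [|/= _ [_] [r] -> <-].
  exact: RGenCInfty.measurableE.
apply: is_interval_measurable => s t/= [si _] [ti ft] u /andP[su ut].
move: ft; rewrite in_itv/= andbT => ft.
have ui : u \in i := interval_is_interval si ti (introT andP (conj su ut)).
by split => //; rewrite in_itv/= andbT (le_trans ft)// fi.
Qed.

Lemma measurable_inv_itv01 (R : realType) :
  measurable_fun (`]0, 1]%classic : set (measurableTypeR R)) (fun a : R => a^-1).
Proof.
apply: measurable_fun_nonincreasing_itv => x y.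
rewrite !in_itv/= => /andP[x0 _] /andP[y0 _] xy.
by rewrite lef_pV2.
Qed.

(** * Tonelli's theorem on a rectangle *)

Section fubini_rectangle.
Local Open Scope ereal_scope.
Context d1 d2 (T1 : measurableType d1) (T2 : measurableType d2) (R : realType).
Variable m1 : {sigma_finite_measure set T1 -> \bar R}.
Variable m2 : {sigma_finite_measure set T2 -> \bar R}.
Variables (A : set T1) (B : set T2) (f : T1 * T2 -> \bar R).
Hypotheses (mA : measurable A) (mB : measurable B).
Hypothesis mf : measurable_fun (A `*` B) f.
Hypothesis f0 : forall x y, A x -> B y -> 0 <= f (x, y).

(** Extension by zero makes measurability and nonnegativity global, as Tonelli's theorem on the
    whole product demands; the integrated sections are again extensions by zero. *)
Let F := f \_ (A `*` B).

Let mF : measurable_fun setT F.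
Proof. by apply/(measurable_restrictT _ _).1 => //; exact: measurableX. Qed.

Let F0 z : 0 <= F z.
Proof. by apply: erestrict_ge0 => -[x y] [] /=; exact: f0. Qed.

Let sec1 x : \int[m2]_y F (x, y) = ((fun x => \int[m2]_(y in B) f (x, y)) \_ A) x.
Proof.
rewrite /F !patchE; case: ifPn => [xA|xA].
  rewrite [RHS]integral_mkcond; apply: eq_integral => y _.
  by rewrite !patchE in_setX/= xA.
apply: integral0_eq => y _.
by rewrite patchE in_setX/= (negbTE xA).
Qed.

Let sec2 y : \int[m1]_x F (x, y) = ((fun y => \int[m1]_(x in A) f (x, y)) \_ B) y.
Proof.
rewrite /F !patchE; case: ifPn => [yB|yB].
  rewrite [RHS]integral_mkcond; apply: eq_integral => x _.
  by rewrite !patchE in_setX/= yB andbT.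
apply: integral0_eq => x _.
by rewrite patchE in_setX/= (negbTE yB) andbF.
Qed.

Lemma fubini_rectangle1 :
  \int[m1 \x m2]_(z in A `*` B) f z = \int[m1]_(x in A) \int[m2]_(y in B) f (x, y).
Proof.
rewrite integral_mkcond fubini_tonelli1// [RHS]integral_mkcond.
by apply: eq_integral => x _; exact: sec1.
Qed.

Lemma fubini_rectangle2 :
  \int[m1 \x m2]_(z in A `*` B) f z = \int[m2]_(y in B) \int[m1]_(x in A) f (x, y).
Proof.
rewrite integral_mkcond fubini_tonelli2// [RHS]integral_mkcond.
by apply: eq_integral => y _; exact: sec2.
Qed.

Lemma fubini_rectangle :
  \int[m1]_(x in A) \int[m2]_(y in B) f (x, y) =
  \int[m2]_(y in B) \int[m1]_(x in A) f (x, y).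
Proof. by rewrite -fubini_rectangle1 fubini_rectangle2. Qed.

Lemma measurable_integral_section1 :
  measurable_fun A (fun x => \int[m2]_(y in B) f (x, y)).
Proof.
apply/(measurable_restrictT _ _).2 => //.
have := measurable_fun_fubini_tonelli_F (m2 := m2) _ mF F0.
by apply: eq_measurable_fun => x _; exact: sec1.
Qed.

End fubini_rectangle.

(** * Double integrals over the index [a] and the level [x] *)

Section level_integral.
Context (R : realType) (mu : probability (measurableTypeR R) R).
Implicit Types (s b : R -> R) (f h : R -> R -> R).

Local Notation I1 := (`]0, 1]%classic : set R).
Local Notation Ry := (`[0, +oo[%classic : set R).
Local Notation Dom := (I1 `*` Ry).

Definition mfun2 f :=
  measurable_fun Dom (fun z : measurableTypeR R * measurableTypeR R => f z.1 z.2).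

(** With the product integral as primitive, comparison, additivity, Fatou's lemma and dominated
    convergence apply directly to functions of (a, x). Integrating over [x] first yields expected
    costs, over [a] first distorted expectations. *)
Definition level_int f : \bar R :=
  (\int[mu \x lebesgue_measure]_(z in Dom) (f z.1 z.2)%:E)%E.

Lemma mDom : measurable (Dom : set (measurableTypeR R * measurableTypeR R)).
Proof. exact: measurableX. Qed.

Lemma level_intE f : mfun2 f -> (forall a x, 0 < a <= 1 -> 0 <= x -> 0 <= f a x) ->
  level_int f = (\int[mu]_(a in `]0%R, 1%R]) \int[lebesgue_measure]_(x in `[0%R, +oo[) (f a x)%:E)%E.
Proof.
move=> mf f0; rewrite /level_int fubini_rectangle1//.
- exact/measurable_EFinP.
- by move=> x y /=; rewrite !in_itv/= andbT => x0 y0; rewrite lee_fin f0.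
Qed.

Lemma level_intE' f : mfun2 f -> (forall a x, 0 < a <= 1 -> 0 <= x -> 0 <= f a x) ->
  level_int f = (\int[lebesgue_measure]_(x in `[0%R, +oo[) \int[mu]_(a in `]0%R, 1%R]) (f a x)%:E)%E.
Proof.
move=> mf f0; rewrite /level_int fubini_rectangle2//.
- exact/measurable_EFinP.
- by move=> x y /=; rewrite !in_itv/= andbT => x0 y0; rewrite lee_fin f0.
Qed.

Lemma DomP (z : R * R) : Dom z -> 0 < z.1 <= 1 /\ 0 <= z.2.
Proof. by case: z => a x [] /=; rewrite !in_itv/= andbT. Qed.

Lemma le_level_int f h : mfun2 f -> mfun2 h ->
  (forall a x, 0 < a <= 1 -> 0 <= x -> 0 <= f a x) ->
  (forall a x, 0 < a <= 1 -> 0 <= x -> f a x <= h a x) -> (level_int f <= level_int h)%E.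
Proof.
move=> mf mh f0 fh; apply: ge0_le_integral => //.
- exact: mDom.
- by move=> z /DomP[? ?]; rewrite lee_fin f0.
- exact/measurable_EFinP.
- exact/measurable_EFinP.
- by move=> z /DomP[? ?]; rewrite lee_fin fh.
Qed.

Lemma level_int_ge0 f : (forall a x, 0 < a <= 1 -> 0 <= x -> 0 <= f a x) -> (0 <= level_int f)%E.
Proof. by move=> f0; apply: integral_ge0 => z /DomP[? ?]; rewrite lee_fin f0. Qed.

Lemma level_intD f h : mfun2 f -> mfun2 h ->
  (forall a x, 0 < a <= 1 -> 0 <= x -> 0 <= f a x) ->
  (forall a x, 0 < a <= 1 -> 0 <= x -> 0 <= h a x) ->
  level_int (fun a x => f a x + h a x) = (level_int f + level_int h)%E.
Proof.
move=> mf mh f0 h0; rewrite /level_int.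
under eq_integral do rewrite EFinD.
rewrite ge0_integralD//.
- exact: mDom.
- by move=> z /DomP[? ?]; rewrite lee_fin f0.
- exact/measurable_EFinP.
- by move=> z /DomP[? ?]; rewrite lee_fin h0.
- exact/measurable_EFinP.
Qed.

Lemma level_intZ f c : mfun2 f -> 0 <= c ->
  (forall a x, 0 < a <= 1 -> 0 <= x -> 0 <= f a x) ->
  level_int (fun a x => c * f a x) = (c%:E * level_int f)%E.
Proof.
move=> mf c0 f0; rewrite /level_int.
under eq_integral do rewrite EFinM.
rewrite ge0_integralZl_EFin//.
- exact: mDom.
- by move=> z /DomP[? ?]; rewrite lee_fin f0.
- exact/measurable_EFinP.
Qed.

Lemma level_int_sum N (f : nat -> R -> R -> R) : (forall j, mfun2 (f j)) ->
  (forall j a x, 0 < a <= 1 -> 0 <= x -> 0 <= f j a x) ->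
  level_int (fun a x => \sum_(j < N) f j a x) = (\sum_(j < N) level_int (f j))%E.
Proof.
move=> mf f0; rewrite /level_int.
under eq_integral do rewrite -sumEFin.
rewrite ge0_integral_sum//.
- exact: mDom.
- by move=> j; apply/measurable_EFinP; exact: mf.
- by move=> j z /DomP[? ?]; rewrite lee_fin f0.
Qed.

Lemma mfun2D f h : mfun2 f -> mfun2 h -> mfun2 (fun a x => f a x + h a x).
Proof. by move=> mf mh; exact: measurable_funD. Qed.

Lemma mfun2_cst c : mfun2 (fun=> fun=> c).
Proof. exact: measurable_cst. Qed.

Lemma mfun2_sum N (f : nat -> R -> R -> R) : (forall j, mfun2 (f j)) ->
  mfun2 (fun a x => \sum_(j < N) f j a x).
Proof. 
move=> mf; apply/measurable_EFinP; rewrite (_ : _ \o _ =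
    fun z => (\sum_(j < N) (f j z.1 z.2)%:E)%E); last first.
  by apply/funext => z /=; rewrite sumEFin.
by apply: emeasurable_sum => j; apply/measurable_EFinP; exact: mf.
 Qed.

Lemma mfun2_inv : mfun2 (fun a x => a^-1).
Proof.
apply: (measurable_comp (F := I1)) (@measurable_inv_itv01 R) _ => //.
  by move=> _ [[a x] /= [+ _] <-].
by apply: measurable_funS measurable_fst.
Qed.

Lemma mfun2_snd s : measurable_fun Ry s -> mfun2 (fun a x => s x).
Proof.
move=> ms; apply: (measurable_comp (F := Ry)) ms _ => //.
  by move=> _ [[a x] /= [_ +] <-].
apply: measurable_funS measurable_snd => //.
Qed.

Lemma mfun2_fst s : measurable_fun I1 s -> mfun2 (fun a x => s a).
Proof.
move=> ms; apply: (measurable_comp (F := I1)) ms _ => //.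
  by move=> _ [[a x] /= [+ _] <-].
apply: measurable_funS measurable_fst => //.
Qed.

Lemma mfun2_if f h k l : mfun2 f -> mfun2 h -> mfun2 k -> mfun2 l ->
  mfun2 (fun a x => if f a x <= h a x then k a x else l a x).
Proof.
move=> mf mh mk ml; apply: measurable_fun_if => //.
- exact: mDom.
- exact: measurable_fun_ler.
- by apply: measurable_funS mk => //; exact: mDom.
- by apply: measurable_funS ml => //; exact: mDom.
Qed.

Lemma mfun2_tmin s : measurable_fun Ry s -> mfun2 (fun a x => tmin a (s x)).
Proof.
move=> ms; apply: measurable_minr; last exact: mfun2_cst.
by apply: measurable_funM; [exact: mfun2_snd|exact: mfun2_inv].
Qed.

Lemma mfun2_tang s b : measurable_fun Ry s -> measurable_fun Ry b ->
  mfun2 (fun a x => tang a (s x) (b x)).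
Proof.
move=> ms mb; apply: (@mfun2_if (fun=> s) (fun a _ => a) (fun a x => b x / a) (fun=> fun=> 1)).
- exact: mfun2_snd.
- by apply: (mfun2_fst (s := id)).
- by apply: measurable_funM; [exact: mfun2_snd|exact: mfun2_inv].
- exact: mfun2_cst.
Qed.

End level_integral.

(** * Tail functions and their generalized inverses *)

Section tail_functions.
Context (R : realType).
Implicit Types (s b : R -> R) (a c x : R).

(* The right-continuity clause is stated for nonincreasing functions. *)
Definition tailfun s := [/\ forall x, 0 <= x -> 0 <= s x,
  forall x y, 0 <= x -> x <= y -> s y <= s x,
  forall x e, 0 <= x -> 0 < e -> exists2 y, x < y & s x <= s y + e &
  forall e, 0 < e -> exists2 x, 0 <= x & s x <= e].

Lemma tailfunD s b : tailfun s -> tailfun b -> tailfun (fun x => s x + b x).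
Proof.
move=> [s0 sd sr sv] [b0 bd br bv]; split.
- by move=> x x0; rewrite addr_ge0 ?s0 ?b0.
- by move=> x y x0 xy; rewrite lerD ?sd ?bd.
- move=> x e x0 e0; have e20 : 0 < e / 2 by lra.
  have [y1 xy1 h1] := sr _ _ x0 e20; have [y2 xy2 h2] := br _ _ x0 e20.
  exists (Num.min y1 y2); first by rewrite lt_min xy1.
  have m0 : 0 <= Num.min y1 y2 by rewrite le_min !(ltW (le_lt_trans x0 _)).
  have := sd _ y1 m0; rewrite ge_min lexx => /(_ isT).
  have := bd _ y2 m0; rewrite ge_min lexx orbT => /(_ isT).
  by lra.
- move=> e e0; have e20 : 0 < e / 2 by lra.
  have [x1 x10 h1] := sv _ e20; have [x2 x20 h2] := bv _ e20.
  exists (Num.max x1 x2); first by rewrite le_max x10.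
  have := sd x1 (Num.max x1 x2) x10; rewrite le_max lexx => /(_ isT).
  have := bd x2 (Num.max x1 x2) x20; rewrite le_max lexx orbT => /(_ isT).
  by lra.
Qed.

Lemma tailfunZ s c : 0 <= c -> tailfun s -> tailfun (fun x => c * s x).
Proof.
rewrite le_eqVlt => /predU1P[<- _|c0 [s0 sd sr sv]].
  split => [x _|x y _ _|x e x0 e0|e e0]; rewrite ?mul0r//.
    by exists (x + 1); [lra|rewrite !mul0r add0r ltW].
  by exists 0 => //; rewrite mul0r ltW.
split.
- by move=> x x0; rewrite mulr_ge0 ?s0// ltW.
- by move=> x y x0 xy; rewrite ler_pM2l ?sd.
- move=> x e x0 e0; have [|y xy h] := sr x (e / c) x0; first by rewrite divr_gt0.
  exists y => //; rewrite -(ler_pM2l c0) in h; apply: (le_trans h).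
  by rewrite mulrDr mulrCA divff ?gt_eqF// mulr1.
- move=> e e0; have [|x x0 h] := sv (e / c); first by rewrite divr_gt0.
  by exists x => //; rewrite mulrC -ler_pdivlMr.
Qed.

Lemma tailfun_measurable s : tailfun s ->
  measurable_fun (`[0, +oo[%classic : set (measurableTypeR R)) s.
Proof.
case=> _ sd _ _; apply: measurable_fun_nonincreasing_itv => x y.
rewrite !in_itv/= !andbT => x0 _; exact: sd.
Qed.

(** The value at 1 is imposed by the constraint Z(1) = 0. It is a genuine exception, since a sum of
    tails may exceed 1 at level 0. *)
Definition tail_quantile s (a : R) : R :=
  if a == 1 then 0 else inf [set x | 0 <= x /\ s x <= a].

Lemma tail_quantile1 s : tail_quantile s 1 = 0.
Proof. by rewrite /tail_quantile eqxx. Qed.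

Let has_inf_tail s a : tailfun s -> 0 < a -> has_inf [set x | 0 <= x /\ s x <= a].
Proof.
case=> s0 sd sr sv a0; split; last by exists 0 => x [].
by have [x x0 sx] := sv _ a0; exists x.
Qed.

Lemma tail_quantile_ge0 s a : tailfun s -> 0 < a -> 0 <= tail_quantile s a.
Proof.
move=> ts a0; rewrite /tail_quantile; case: ifP => // _.
by apply: lb_le_inf; [exact: (has_inf_tail ts a0).1|move=> x []].
Qed.

(** The Galois connection between a tail and its generalized inverse. Right-continuity puts the
    infimum into the set, which is the direction from left to right. *)
Lemma tail_quantile_le s a x : tailfun s -> 0 < a -> a != 1 -> 0 <= x ->
  (tail_quantile s a <= x) = (s x <= a).
Proof.
move=> ts a0 a1 x0; rewrite /tail_quantile (negbTE a1); apply/idP/idP => [h|h].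
  case: (ts) => s0 sd sr sv; rewrite leNgt; apply/negP => asx.
  have e0 : 0 < (s x - a) / 2 by lra.
  have [y xy h1] := sr _ _ x0 e0.
  have [z [z0 sz] zy] := inf_lt (has_inf_tail ts a0).1 (le_lt_trans h xy).
  have := sd _ _ z0 (ltW zy); lra.
by apply: ge_inf; [exact: (has_inf_tail ts a0).2|split].
Qed.

Lemma tail_quantile_nonincr s a c : tailfun s -> 0 < a -> a <= c -> c <= 1 ->
  tail_quantile s c <= tail_quantile s a.
Proof.
move=> ts a0 ac c1; have c0 := lt_le_trans a0 ac.
have [->|cn1] := eqVneq c 1; first by rewrite tail_quantile1 tail_quantile_ge0.
have an1 : a != 1 by rewrite lt_eqF// (le_lt_trans ac)// lt_neqAle cn1.
rewrite tail_quantile_le ?tail_quantile_ge0//.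
by apply: le_trans ac; rewrite -tail_quantile_le ?tail_quantile_ge0.
Qed.

Lemma tail_quantile_measurable s : tailfun s ->
  measurable_fun (`]0, 1]%classic : set (measurableTypeR R)) (tail_quantile s).
Proof.
move=> ts; apply: measurable_fun_nonincreasing_itv => x y.
rewrite !in_itv/= => /andP[x0 _] /andP[_ y1] xy; exact: tail_quantile_nonincr.
Qed.

(* With b the survival function of X, the integral of lev Z b a over x >= 0 is
   the expectation of (X - Z a)^+ / a + Z a. *)
Definition lev (Z : R -> R) b (a x : R) : R := if Z a <= x then b x / a else 1.

Lemma lev_ge0 Z b a x : 0 < a -> 0 <= b x -> 0 <= lev Z b a x.
Proof. by move=> a0 b0; rewrite /lev; case: ifP => // _; rewrite divr_ge0// ltW. Qed.

Lemma tmin_le_lev Z b a x : tmin a (b x) <= lev Z b a x.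
Proof. by rewrite /tmin /lev ge_min; case: ifP; rewrite lexx ?orbT. Qed.

(** Away from [a = 1] the two case distinctions coincide and equality holds. At 1 the imposed value
    0 selects [b x], and [b x <= 1] keeps it below the flat branch of the tangent. *)
Lemma lev_tail_quantile s b a x : tailfun s -> 0 < a <= 1 -> 0 <= x -> b x <= 1 ->
  lev (tail_quantile s) b a x <= tang a (s x) (b x).
Proof.
move=> ts /andP[a0 a1] x0 b1; rewrite /lev /tang.
have [->|an1] := eqVneq a 1.
  by rewrite tail_quantile1 x0 divr1; case: ifP.
by rewrite tail_quantile_le.
Qed.

Lemma measurable_lev Z b :
  measurable_fun (`]0, 1]%classic : set (measurableTypeR R)) Z ->
  measurable_fun (`[0, +oo[%classic : set (measurableTypeR R)) b ->
  mfun2 (lev Z b).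
Proof.
move=> mZ mb; apply: (@mfun2_if _ (fun a _ => Z a) (fun _ x => x) (fun a x => b x / a)
  (fun=> fun=> 1)).
- exact: mfun2_fst.
- exact: (mfun2_snd (s := id)).
- by apply: measurable_funM; [exact: mfun2_snd|exact: mfun2_inv].
- exact: mfun2_cst.
Qed.

End tail_functions.

(** * Survival functions and the layer-cake formula *)

Section survival.
Context (R : realType) (d : measure_display) (Omega : measurableType d).
Context (P : probability Omega R).
Implicit Types X : Omega -> R.

Definition surv X (x : R) : R := 1 - dist_fun P X x.

Lemma measurable_gt X x : measurable_fun setT X -> measurable [set w | x < X w].
Proof.
move=> mX; have := mX measurableT _ (measurable_itv (`]x, +oo[ : interval R)).
by rewrite setTI; congr measurable; apply/seteqP; split => w /=; rewrite in_itv/= andbT.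
Qed.

Let le_setE X x : [set w | X w <= x] = setT `\` [set w : Omega | x < X w].
Proof.
apply/seteqP; split => w /=.
  by move=> h; split => //; apply/negP; rewrite -leNgt.
by move=> [_ /negP]; rewrite -leNgt.
Qed.

Lemma survE X x : measurable_fun setT X -> surv X x = pr P [set w | x < X w].
Proof.
move=> mX; have mg := measurable_gt x mX.
rewrite /surv /dist_fun -/(pr P _) -(prT P).
rewrite le_setE prD//; lra.
Qed.

Lemma surv_le1 X x : surv X x <= 1.
Proof. by rewrite /surv gerBl fine_ge0. Qed.

Lemma surv_ge0 X x : measurable_fun setT X -> 0 <= surv X x.
Proof. by move=> mX; rewrite survE// pr_ge0. Qed.

Lemma surv_le X X' x : measurable_fun setT X -> measurable_fun setT X' ->
  (forall w, X w <= X' w) -> surv X x <= surv X' x.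
Proof.
move=> mX mX' XX'; rewrite !survE//; apply: le_pr; [exact: measurable_gt|exact: measurable_gt|].
by move=> w /= /lt_le_trans; exact.
Qed.

(** Both limit clauses are continuity from below of the probability: along the levels x + 1/(n+1)
    for right-continuity, along the events X <= n for the decay at infinity. *)
Lemma surv_tailfun X : measurable_fun setT X -> tailfun (surv X).
Proof.
move=> mX; split.
- by move=> x _; exact: surv_ge0.
- move=> x y _ xy; rewrite !survE//; apply: le_pr; [exact: measurable_gt|exact: measurable_gt|].
  by move=> w /=; exact: le_lt_trans.
- move=> x e x0 e0.
  pose E n := [set w | x + n.+1%:R^-1 < X w].
  have cvE : pr P (E n) @[n --> \oo] --> pr P (\bigcup_n E n).
    apply: pr_bigcup_cvg => [n|]; first exact: measurable_gt.
    move=> m n mn; apply/subsetPset => w; rewrite /E/=; apply: le_lt_trans.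
    by rewrite lerD2l lef_pV2 ?posrE// ler_nat ltnS.
  have eE : \bigcup_n E n = [set w | x < X w].
    apply/seteqP; split => w.
      by move=> [n _]; rewrite /E/=; apply: lt_trans; rewrite ltrDl invr_gt0.
    move=> /= xX; exists (Num.truncn (X w - x)^-1) => //; rewrite /E/=.
    rewrite -ltrBrDl invf_plt ?posrE ?subr_gt0//.
    exact: truncnS_gt.
  move: cvE; rewrite eE -survE// => /cvgrPdist_lt/(_ _ e0)[n _ /(_ _ (leqnn n))] /=.
  rewrite -[pr P (E n)]survE// => /ltW; rewrite ler_norml => /andP[_ h].
  by exists (x + n.+1%:R^-1); [rewrite ltrDl invr_gt0|lra].
- move=> e e0.
  pose E n := [set w | X w <= n%:R].
  have mE n : measurable (E n).
    have -> : E n = setT `\` [set w | n%:R < X w].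
      exact: le_setE.
    by apply: measurableD => //; exact: measurable_gt.
  have cvE : pr P (E n) @[n --> \oo] --> pr P (\bigcup_n E n).
    apply: pr_bigcup_cvg => // m n mn; apply/subsetPset => w /= /le_trans; apply.
    by rewrite ler_nat.
  have eE : \bigcup_n E n = setT.
    apply/seteqP; split => // w _; exists (Num.truncn (X w)).+1 => //.
    by rewrite /E/= ltW// truncnS_gt.
  move: cvE; rewrite eE prT => /cvgrPdist_lt/(_ _ e0)[n _ /(_ _ (leqnn n))] /=.
  move=> /ltW; rewrite ler_norml => /andP[_ h].
  by exists n%:R => //; rewrite /surv /dist_fun.
Qed.

Lemma surv_lt0 X x : (forall w, 0 <= X w) -> x < 0 -> surv X x = 1.
Proof.
move=> X0 x0; rewrite /surv /dist_fun (_ : [set w | _] = set0) ?measure0 ?subr0//.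
by apply/seteqP; split => // w /= Xx; have := X0 w; rewrite leNgt (le_lt_trans Xx x0).
Qed.

(** Levels below [z] contribute [z], those between [z] and [y] contribute the excess divided by
    [a]. *)
Lemma level_integral1 (y z a : R) : 0 <= y -> 0 <= z -> 0 < a ->
  (\int[lebesgue_measure]_(x in `[0%R, +oo[)
     (if z <= x then (x < y)%R%:R / a else 1%R)%:E)%E =
  (Num.max (y - z) 0 / a + z)%:E.
Proof.
move=> y0 z0 a0.
transitivity (\int[lebesgue_measure]_(x in `[0%R, +oo[) ((\1_(`[0, z[ : set R) x)%:E +
    (a^-1)%:E * (\1_(`[z, y[ : set R) x)%:E))%E.
  apply: eq_integral => x; rewrite inE/= in_itv/= andbT => x0.
  rewrite !indicE !mem_setE !in_itv/= x0 -EFinM -EFinD; congr EFin.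
  by case: (leP z x) => _ /=; rewrite ?add0r ?mulr0 ?addr0// [RHS]mulrC.
rewrite ge0_integralD//=; last 3 first.
- by apply/measurable_EFinP; exact: measurable_indic.
- by move=> x _; rewrite -EFinM lee_fin mulr_ge0// invr_ge0 ltW.
- apply: emeasurable_funM; first exact: measurable_cst.
  by apply/measurable_EFinP; exact: measurable_indic.
rewrite ge0_integralZl_EFin//; last 2 first.
- by apply/measurable_EFinP; exact: measurable_indic.
- by rewrite invr_ge0 ltW.
rewrite !integral_indic//.
rewrite setIidl; last by move=> x /=; rewrite !in_itv/= andbT => /andP[].
rewrite setIidl; last by move=> x /=; rewrite !in_itv/= andbT => /andP[/(le_trans z0)].
have len (u v : R) : u <= v ->
    lebesgue_measure (`[u, v[%classic : set R) = (v - u)%:E.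
  rewrite lebesgue_measure_itv/= lte_fin le_eqVlt => /predU1P[->|->]//.
  by rewrite ltxx subrr.
rewrite [X in (X + _)%E]len// subr0.
have [yz|zy] := leP y z.
  rewrite [X in (_ + _ * X)%E](_ : _ = 0%E); last first.
    by rewrite set_itv_ge ?measure0// bnd_simp -leNgt.
  rewrite mule0 adde0 (_ : Num.max _ _ = 0) ?mul0r ?add0r//.
  by apply/max_idPr; lra.
rewrite [X in (_ + _ * X)%E]len ?ltW// -EFinM -EFinD (_ : Num.max _ _ = y - z).
  by rewrite addrC mulrC.
by apply/max_idPl; lra.
Qed.

Lemma layer_cake X (z a : R) : measurable_fun setT X -> (forall w, 0 <= X w) ->
  0 <= z -> 0 < a ->
  (\int[P]_w (Num.max (X w - z) 0 / a + z)%:E =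
   \int[lebesgue_measure]_(x in `[0%R, +oo[) (if z <= x then surv X x / a else 1%R)%:E)%E.
Proof.
move=> mX X0 z0 a0.
under eq_integral do rewrite -level_integral1//.
pose f (q : Omega * measurableTypeR R) : \bar R :=
  (if z <= q.2 then (q.2 < X q.1)%R%:R / a else 1%R)%:E.
have mf : measurable_fun (setT `*` (`[0, +oo[%classic : set (measurableTypeR R))) f.
  apply: (@measurable_funS _ _ _ _ setT) => //.
  apply/measurable_EFinP; apply: measurable_fun_ifT.
  - by apply: measurable_fun_ler => //; exact: measurable_snd.
  - apply: measurable_funM => //.
    rewrite (_ : (fun q => _) = (fun q : Omega * measurableTypeR R =>
        if q.2 < X q.1 then 1 else 0 : R)); last by apply/funext => q; case: ifP.
    apply: measurable_fun_ifT => //.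
    apply: measurable_fun_ltr; first exact: measurable_snd.
    by apply: measurableT_comp mX _; exact: measurable_fst.
  - exact: measurable_cst.
rewrite (@fubini_rectangle _ _ _ _ R P lebesgue_measure _ _ f)//; last first.
  move=> w x _ _; rewrite /f/= lee_fin; case: ifP => // _.
  by rewrite divr_ge0// ltW.
apply: eq_integral => x _; rewrite /f/=.
case: ifP => zx; last first.
  by rewrite integral_cst// [X in (_ * X)%E](_ : _ = 1%E) ?mule1//; exact: probability_setT.
under eq_integral do rewrite mulrC EFinM.
have mg := measurable_gt x mX.
rewrite (_ : (fun w => _) = (fun w => (a^-1)%:E * (\1_[set w | x < X w] w)%:E)%E); last first.
  apply/funext => w; rewrite indicE; case: (boolP (x < X w)) => h.
    by rewrite mem_set.
  by rewrite memNset//; exact/negP.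
rewrite ge0_integralZl_EFin//; last 2 first.
- by apply/measurable_EFinP; exact: measurable_indic.
- by rewrite invr_ge0 ltW.
rewrite integral_indic// setIT survE// mulrC EFinM; congr (_ * _)%E; exact: prE.
Qed.

End survival.
(** * Distortions as mixtures *)

Section distortion_integral.
Context (R : realType).

(** The three-point form of concavity, where [x] has weight (y - z) / (y - x); denominators are
    cleared so that linear arithmetic can use it. *)
Lemma concave_on01_chord (g : R -> R) x z y : concave_on01 g ->
  0 <= x -> x < z -> z < y -> y <= 1 ->
  (y - z) * g x + (z - x) * g y <= (y - x) * g z.
Proof.
move=> cg x0 xz zy y1.
have yx0 : 0 < y - x by lra.
have t0 : 0 <= (y - z) / (y - x) by rewrite divr_ge0//; lra.
have t1 : (y - z) / (y - x) <= 1 by rewrite ler_pdivrMr// mul1r; lra.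
have xI : x \in (`[0, 1]%classic : set R) by rewrite inE/= in_itv/=; lra.
have yI : y \in (`[0, 1]%classic : set R) by rewrite inE/= in_itv/=; lra.
have oE : unstable.onem ((y - z) / (y - x)) = (z - x) / (y - x).
  rewrite /unstable.onem -[X in X - _](@divff _ (y - x)) ?gt_eqF// -mulrBl.
  by congr (_ / _); lra.
have cE : conv (Itv01 t0 t1) (x : R^o) (y : R^o) = z.
  rewrite convRE/= oE.
  rewrite mulrAC -[_ / _ * y]mulrAC -mulrDl.
  by apply: (canLR (mulfK _)); rewrite ?gt_eqF//; lra.
have := cg (Itv01 t0 t1) x y xI yI.
rewrite [X in g X](_ : _ = z); last exact: cE.
rewrite convRE/= oE.
have eA : (y - x) * ((y - z) / (y - x)) = y - z by rewrite mulrCA divff ?gt_eqF// mulr1.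
have eB : (y - x) * ((z - x) / (y - x)) = z - x by rewrite mulrCA divff ?gt_eqF// mulr1.
move: eA eB; set A := (y - z) / _; set B := (z - x) / _ => eA eB.
rewrite -(ler_pM2l yx0) (_ : _ * (A * - g x + B * - g y) =
  - (((y - x) * A) * g x + ((y - x) * B) * g y)); last by lra.
by rewrite eA eB mulrN lerN2.
Qed.

(* The common bounds on the increments leave a gap of total size at most
   (D x - D 1) * mesh over an equidistant partition. *)
Lemma sandwich_increment (G H D : R -> R) x : 0 < x -> x <= 1 ->
  (forall u v, x <= u -> u <= v -> v <= 1 ->
    D v * (v - u) <= G v - G u /\ G v - G u <= D u * (v - u)) ->
  (forall u v, x <= u -> u <= v -> v <= 1 ->
    D v * (v - u) <= H v - H u /\ H v - H u <= D u * (v - u)) ->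
  G 1 - G x = H 1 - H x.
Proof.
move=> x0 x1 GD HD.
have bnd n : n.+1%:R * `|(G 1 - G x) - (H 1 - H x)| <= (D x - D 1) * (1 - x).
  pose m := (1 - x) / n.+1%:R.
  have nm : n.+1%:R * m = 1 - x by rewrite /m mulrC divfK// pnatr_eq0.
  have m0 : 0 <= m by rewrite divr_ge0//; lra.
  pose p i := x + i%:R * m.
  have p0 : p 0%N = x by rewrite /p mul0r addr0.
  have pn : p n.+1 = 1 by rewrite /p nm; lra.
  have pS i : p i.+1 - p i = m by rewrite /p -natr1; lra.
  have px i : x <= p i by rewrite /p lerDl mulr_ge0.
  have p1 i : (i < n.+1)%N -> p i.+1 <= 1.
    by move=> i1; rewrite -pn /p lerD2l ler_wpM2r// ler_nat.
  have -> : (G 1 - G x) - (H 1 - H x) =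
      \sum_(0 <= i < n.+1) ((G (p i.+1) - H (p i.+1)) - (G (p i) - H (p i))).
    by rewrite (telescope_sumr (fun i => G (p i) - H (p i)))// p0 pn; lra.
  have -> : (D x - D 1) * (1 - x) = n.+1%:R * \sum_(0 <= i < n.+1) (- D (p i.+1) - - D (p i)) * m.
    rewrite -mulr_suml (telescope_sumr (fun i => - D (p i)))// p0 pn -nm; lra.
  rewrite ler_pM2l ?ltr0Sn//; apply: (le_trans (ler_norm_sum _ _ _)).
  rewrite !big_mkord; apply: ler_sum => i _.
  have pp : p i <= p i.+1 by have := pS i; lra.
  have [g1 g2] := GD _ _ (px i) pp (p1 _ (ltn_ord i)).
  have [h1 h2] := HD _ _ (px i) pp (p1 _ (ltn_ord i)).
  rewrite pS in g1 g2 h1 h2.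
  by rewrite ler_norml; apply/andP; split; lra.
apply/eqP; rewrite -subr_eq0 -normr_le0 leNgt; apply/negP => e0.
set e := `|_| in bnd e0.
have := bnd (Num.truncn ((D x - D 1) * (1 - x) / e)).
have := truncnS_gt ((D x - D 1) * (1 - x) / e).
by rewrite ltr_pdivrMr// => /lt_le_trans h /h; rewrite ltxx.
Qed.

Context (mu : probability (measurableTypeR R) R) (g : R -> R).
Hypotheses (dg : distortion g) (cg : concave_on01 g) (mg : is_mu_g g mu).

Local Notation I1 := (`]0, 1]%classic : set R).

(** By [is_mu_g] this is the right-sided derivative of [g] inside ]0, 1[; at 1 the interval is empty
    and the value is 0. *)
Let Dg (x : R) : \bar R := (\int[mu]_(u in `]x, 1%R]) ((u : R)^-1)%:E)%E.

Let mI1 : measurable (I1 : set (measurableTypeR R)).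
Proof. exact: measurable_itv. Qed.

Let DgE x : 0 < x -> Dg x = (\int[mu]_(u in `]0%R, 1%R]) (if x < u then u^-1 else 0)%:E)%E.
Proof.
move=> x0; rewrite /Dg [LHS]integral_mkcond [RHS]integral_mkcond.
apply: eq_integral => u _; rewrite !patchE !mem_setE !in_itv/=.
case: ltP => xu/=; last by case: ifP.
by rewrite (lt_trans x0 xu).
Qed.

Let minv (x : R) : measurable_fun (I1 : set (measurableTypeR R))
  (fun u => if x < u then u^-1 else 0).
Proof.
apply: measurable_fun_if => //.
- exact: measurable_fun_ltr.
- by apply: (@measurable_funS _ _ _ _ I1) => //; exact: measurable_inv_itv01.
Qed.

Let Dg_fin x : 0 < x -> Dg x \is a fin_num.
Proof.
move=> x0; rewrite ge0_fin_numE; last first.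
  apply: integral_ge0 => u /=; rewrite in_itv/= => /andP[/(lt_trans x0) u0 _].
  by rewrite lee_fin invr_ge0 ltW.
rewrite DgE//; apply: (@le_lt_trans _ _ (\int[mu]_(u in I1) (x^-1)%:E)%E).
  apply: ge0_le_integral => //.
  - by move=> u /=; rewrite in_itv/= => /andP[u0 _]; case: ifP => // _; rewrite lee_fin invr_ge0 ltW.
  - by apply/measurable_EFinP; exact: minv.
  - move=> u /=; rewrite in_itv/= => /andP[u0 _]; rewrite lee_fin.
    by case: ifP => [xu|_]; [rewrite lef_pV2 ?posrE// ltW|rewrite invr_ge0 ltW].
by rewrite integral_cst// [X in (_ * X)%E](_ : _ = 1%E) ?mule1 ?ltry//; exact: mg.1.
Qed.

Let h (x : R) : \bar R := (\int[mu]_(a in `]0%R, 1%R]) (tmin a x)%:E)%E.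

Let mtmin (x : R) : measurable_fun (I1 : set (measurableTypeR R)) (fun a => tmin a x).
Proof.
apply: measurable_minr; last exact: measurable_cst.
by apply: measurable_funM; [exact: measurable_cst|exact: measurable_inv_itv01].
Qed.

Let h_fin x : 0 <= x -> h x \is a fin_num.
Proof.
move=> x0; rewrite ge0_fin_numE; last first.
  by apply: integral_ge0 => a /=; rewrite in_itv/= => /andP[a0 _]; rewrite lee_fin tmin_ge0.
apply: (@le_lt_trans _ _ (\int[mu]_(u in I1) 1%:E)%E).
  apply: ge0_le_integral => //.
  - by move=> a /=; rewrite in_itv/= => /andP[a0 _]; rewrite lee_fin tmin_ge0.
  - by apply/measurable_EFinP; exact: mtmin.
  - by move=> a _; rewrite lee_fin /tmin ge_min lexx orbT.
by rewrite integral_cst// [X in (_ * X)%E](_ : _ = 1%E) ?mule1 ?ltry//; exact: mg.1.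
Qed.

(** For each [a], the increment of [tmin a] from [x] to [y] is exactly (y - x) / a if y < a, at most
    that if x < a, and 0 if a <= x. Integration turns these bounds into values of [Dg]. *)
Let sandwich_h x y : 0 < x -> x <= y -> y <= 1 ->
  fine (Dg y) * (y - x) <= fine (h y) - fine (h x) /\
  fine (h y) - fine (h x) <= fine (Dg x) * (y - x).
Proof.
move=> x0 xy y1; have y0 := lt_le_trans x0 xy.
have hD u v z : 0 < u -> 0 <= v -> 0 <= z ->
  (\int[mu]_(a in `]0%R, 1%R]) (tmin a v + z * (if u < a then a^-1 else 0))%:E =
   (fine (h v) + fine (Dg u) * z)%:E)%E.
  move=> u0 v0 z0; rewrite EFinD EFinM fineK ?h_fin// fineK ?Dg_fin//.
  under eq_integral do rewrite EFinD EFinM.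
  rewrite ge0_integralD//; last 4 first.
  - by move=> a /=; rewrite in_itv/= => /andP[a0 _]; rewrite lee_fin tmin_ge0.
  - by apply/measurable_EFinP; exact: mtmin.
  - move=> a /=; rewrite in_itv/= => /andP[a0 _]; rewrite -EFinM lee_fin.
    by case: ifP => // _; rewrite ?mulr0// mulr_ge0// invr_ge0 ltW.
  - by apply/measurable_EFinP; apply: measurable_funM => //; exact: minv.
  congr (_ + _)%E; rewrite ge0_integralZl_EFin// ?DgE 1?muleC//.
  - move=> a /=; rewrite in_itv/= => /andP[a0 _]; rewrite lee_fin.
    by case: ifP => // _; rewrite invr_ge0 ltW.
  - by apply/measurable_EFinP; exact: minv.
have yx0 : 0 <= y - x by lra.
split.
  rewrite lerBrDr addrC -lee_fin -(hD y x (y - x))//; last exact: ltW.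
  rewrite fineK ?h_fin ?(ltW y0)//; apply: ge0_le_integral => //.
  - move=> a /=; rewrite in_itv/= => /andP[a0 _]; rewrite lee_fin.
    rewrite addr_ge0 ?tmin_ge0 ?mulr_ge0 ?(ltW x0)//.
    by case: ifP => // _; rewrite invr_ge0 ltW.
  - apply/measurable_EFinP; apply: measurable_funD; first exact: mtmin.
    by apply: measurable_funM => //; exact: minv.
  - by apply/measurable_EFinP; exact: mtmin.
  - move=> a /=; rewrite in_itv/= => /andP[a0 _]; rewrite lee_fin.
    case: ifP => [ya|_]; last by rewrite mulr0 addr0 le_tmin.
    rewrite (tmin_tang y)// (tmin_tang x)// /tang (ltW ya) (le_trans xy (ltW ya)).
    by rewrite -mulrDl addrC subrK.
rewrite lerBlDr addrC -lee_fin -(hD x x (y - x))//; last exact: ltW.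
rewrite fineK ?h_fin ?(ltW y0)//; apply: ge0_le_integral => //.
- by move=> a /=; rewrite in_itv/= => /andP[a0 _]; rewrite lee_fin tmin_ge0// ltW.
- by apply/measurable_EFinP; exact: mtmin.
- apply/measurable_EFinP; apply: measurable_funD; first exact: mtmin.
  by apply: measurable_funM => //; exact: minv.
- move=> a /=; rewrite in_itv/= => /andP[a0 _]; rewrite lee_fin.
  case: ltP => [xa|ax].
    rewrite (tmin_tang x)// /tang (ltW xa) -mulrDl addrC subrK.
    by rewrite /tmin ge_min lexx.
  rewrite mulr0 addr0 {2}/tmin (_ : Num.min (x / a) 1 = 1).
    by rewrite /tmin ge_min lexx orbT.
  by apply/min_idPr; rewrite ler_pdivlMr// mul1r.
Qed.

(** A chord of a concave function is at most as steep as the right-sided derivative at its left end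
    and at least as steep as that at its right end; [Dg] is the limit of the difference
    quotients. *)
Let sandwich_g x y : 0 < x -> x <= y -> y <= 1 ->
  fine (Dg y) * (y - x) <= g y - g x /\ g y - g x <= fine (Dg x) * (y - x).
Proof.
move=> x0 xy y1.
move: xy; rewrite le_eqVlt => /predU1P[->|xy]; first by rewrite !subrr !mulr0.
have y0 := lt_trans x0 xy.
have yx0 : 0 < y - x by lra.
have [gI gm g0 g1] := dg.
split.
  (* [is_mu_g] is silent at 1, but [Dg 1] is 0 there and monotonicity of [g] is enough. *)
  have [->|yn1] := eqVneq y 1.
    rewrite (_ : Dg 1 = 0%E) ?mul0r ?subr_ge0; last first.
      by rewrite /Dg set_itv_ge ?integral_set0// bnd_simp ltxx.
    by apply: gm; rewrite ?in_itv/=; lra.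
  have y1' : y < 1 by rewrite lt_neqAle yn1.
  rewrite -ler_pdivlMr// -lee_fin fineK ?Dg_fin//.
  have yI : y \in `]0, 1[ by rewrite in_itv/= y0.
  apply: (cvge_le _ (mg.2 _ yI)).
  near=> e; rewrite lee_fin.
  have e0 : 0 < e by near: e; exact: nbhs_right_gt.
  have e1 : e < 1 - y by near: e; apply: nbhs_right_lt; lra.
  have := @concave_on01_chord g x y (y + e) cg (ltW x0) xy.
  move=> /(_ ltac:(lra) ltac:(lra)) H.
  by rewrite ler_pdivrMr// mulrAC ler_pdivlMr//; lra.
have x1 : x < 1 by lra.
rewrite -ler_pdivrMr// -lee_fin fineK ?Dg_fin//.
have xI : x \in `]0, 1[ by rewrite in_itv/= x0.
apply: (cvge_ge _ (mg.2 _ xI)).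
near=> e; rewrite lee_fin.
have e0 : 0 < e by near: e; exact: nbhs_right_gt.
have e1 : e < y - x by near: e; apply: nbhs_right_lt; lra.
have := @concave_on01_chord g x (x + e) y cg (ltW x0).
move=> /(_ ltac:(lra) ltac:(lra) ltac:(lra)) H.
by rewrite ler_pdivrMr// mulrAC ler_pdivlMr//; lra.
Unshelve. all: by end_near. Qed.

(** [g] and the mixture have increments sandwiched by the same [Dg], hence equal increments, and
    both take the value 1 at 1. The point 0 is treated apart because [Dg] may be infinite there. *)
Lemma distortion_integral x : 0 <= x <= 1 ->
  (g x)%:E = (\int[mu]_(a in `]0%R, 1%R]) (tmin a x)%:E)%E.
Proof.
move=> /andP[]; have [_ _ g0 g1] := dg.
rewrite le_eqVlt => /predU1P[<- _|x0 x1].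
  rewrite g0; under eq_integral do rewrite /tmin mul0r (_ : Num.min 0 1 = 0) ?minEle ?ler01//.
  by rewrite integral0.
rewrite -/(h x) -[RHS]fineK ?h_fin ?(ltW x0)//; congr EFin.
have : g 1 - g x = fine (h 1) - fine (h x).
  apply: (@sandwich_increment g (fine \o h) (fine \o Dg)) => //= u v xu uv v1.
    by apply: sandwich_g => //; exact: lt_le_trans xu.
  by apply: sandwich_h => //; exact: lt_le_trans xu.
rewrite g1 (_ : h 1 = 1%E) /=; first lra.
rewrite /h; under eq_integral => a /[!inE]/= /[!in_itv]/= /andP[a0 a1].
  rewrite /tmin (_ : Num.min _ 1 = 1); last first.
    by apply/min_idPr; rewrite ler_pdivlMr// mul1r.
  over.
by rewrite integral_cst// [X in (_ * X)%E](_ : _ = 1%E) ?mule1//; exact: mg.1.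
Qed.

End distortion_integral.

(** * The dual representation for a single random variable *)

Section dual_functional.
Context (R : realType) (d : measure_display) (Omega : measurableType d).
Context (P : probability Omega R) (mu : probability (measurableTypeR R) R).
Implicit Types (X : Omega -> R) (Z s b : R -> R).

Local Notation I1 := (`]0, 1]%classic : set R).
Local Notation Ry := (`[0, +oo[%classic : set R).

Let mI1 : measurable (I1 : set (measurableTypeR R)).
Proof. exact: measurable_itv. Qed.

Lemma L1plus_measurable Z : L1plus mu Z ->
  measurable_fun (I1 : set (measurableTypeR R)) Z.
Proof. by case=> /integrableP[/measurable_EFinP]. Qed.

Let measurable_product_snd (f : R -> R) :
  measurable_fun (I1 : set (measurableTypeR R)) f ->
  measurable_fun (setT `*` (I1 : set (measurableTypeR R)))
    (fun q : Omega * measurableTypeR R => f q.2).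
Proof.
move=> mf; apply: (measurable_comp (F := I1)) mf _ => //.
  by move=> _ [[a x] /= [_ +] <-].
by apply: measurable_funS measurable_snd.
Qed.

Lemma measurable_excess X Z : measurable_fun setT X ->
  measurable_fun (I1 : set (measurableTypeR R)) Z ->
  measurable_fun (setT `*` (I1 : set (measurableTypeR R)))
    (fun q : Omega * measurableTypeR R => Num.max (X q.1 - Z q.2) 0 / q.2).
Proof.
move=> mX mZ.
apply: measurable_funM; last exact: (measurable_product_snd (@measurable_inv_itv01 R)).
apply: measurable_maxr; last exact: measurable_cst.
apply: measurable_funB; last exact: measurable_product_snd.
apply: (@measurable_funS _ _ _ _ setT) => //.
by apply: measurableT_comp mX _; exact: measurable_fst.
Qed.

Lemma measurable_Ufun_integrand X Z : measurable_fun setT X ->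
  measurable_fun (I1 : set (measurableTypeR R)) Z ->
  measurable_fun (setT `*` (I1 : set (measurableTypeR R)))
    (fun q : Omega * measurableTypeR R => Num.max (X q.1 - Z q.2) 0 / q.2 + Z q.2).
Proof.
move=> mX mZ; apply: measurable_funD; last exact: measurable_product_snd.
exact: measurable_excess.
Qed.

Lemma integral_Ufun X Z : measurable_fun setT X -> (forall w, 0 <= X w) ->
  L1plus mu Z ->
  (\int[P]_w Ufun mu Z (X w) = level_int mu (lev Z (surv P X)))%E.
Proof.
move=> mX X0 LZ; have mZ := L1plus_measurable LZ; have [_ Z0] := LZ.
rewrite /Ufun.
rewrite (@fubini_rectangle _ _ _ _ R P mu setT I1
  (fun q => (Num.max (X q.1 - Z q.2) 0 / q.2 + Z q.2)%:E))//; last 2 first.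
- by apply/measurable_EFinP; exact: measurable_Ufun_integrand.
- move=> w a _ /= aI; move: (aI); rewrite in_itv/= => /andP[a0 _]; rewrite lee_fin.
  by rewrite addr_ge0 ?Z0// divr_ge0 ?(ltW a0)// le_max lexx orbT.
rewrite level_intE; last 2 first.
- apply: measurable_lev => //; apply: tailfun_measurable; exact: surv_tailfun.
- by move=> a x /andP[a0 _] _; apply: lev_ge0 => //; exact: surv_ge0.
apply: eq_integral => a; rewrite inE/= => aI; move: (aI); rewrite in_itv/= => /andP[a0 _].
by rewrite layer_cake//; exact: Z0.
Qed.

(** Replacing [b] by 0 in [lev] leaves the indicator of the levels below Z(a), whose integral is
    that of [Z]; so a finite cost for any single [b] gives integrability. *)
Lemma L1plus0_tail_quantile s b : tailfun s ->
  measurable_fun (Ry : set (measurableTypeR R)) b -> (forall x, 0 <= x -> 0 <= b x) ->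
  (level_int mu (lev (tail_quantile s) b) < +oo)%E -> L1plus0 mu (tail_quantile s).
Proof.
move=> ts mb b0 fin; have mZ := tail_quantile_measurable ts.
have m0 : measurable_fun (Ry : set (measurableTypeR R)) (fun=> 0 : R) by exact: measurable_cst.
split; last exact: tail_quantile1.
split; last by move=> a; rewrite in_itv/= => /andP[a0 _]; exact: tail_quantile_ge0.
apply/integrableP; split; first exact/measurable_EFinP.
apply: le_lt_trans fin.
apply: (@le_trans _ _ (level_int mu (lev (tail_quantile s) (fun=> 0)))).
  rewrite level_intE; last 2 first.
  - exact: measurable_lev.
  - by move=> a x /andP[a0 _] _; exact: lev_ge0.
  rewrite le_eqVlt; apply/orP; left; apply/eqP.
  apply: eq_integral => a; rewrite inE/= in_itv/= => /andP[a0 _].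
  have q0 := tail_quantile_ge0 ts a0.
  rewrite /= ger0_norm//.
  have := level_integral1 (lexx 0) q0 a0.
  rewrite sub0r (_ : Num.max _ _ = 0) ?mul0r ?add0r => [<-|]; last first.
    by apply/max_idPr; rewrite oppr_le0.
  apply: eq_integral => x; rewrite inE/= in_itv/= andbT => x0.
  by rewrite /lev (ltNge x 0) x0.
apply: le_level_int.
- exact: measurable_lev.
- exact: measurable_lev.
- by move=> a x /andP[a0 _] _; exact: lev_ge0.
- move=> a x /andP[a0 _] x0; rewrite /lev; case: ifP => // _.
  by rewrite mul0r divr_ge0 ?b0// ltW.
Qed.

Context (g : R -> R).
Hypotheses (dg : distortion g) (cg : concave_on01 g) (mg : is_mu_g g mu).

Lemma distorted_expE X : measurable_fun setT X ->
  distorted_exp P g X = level_int mu (fun a x => tmin a (surv P X x)).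
Proof.
move=> mX; have ts := surv_tailfun P mX.
rewrite level_intE'; last 2 first.
- by apply: mfun2_tmin; exact: tailfun_measurable.
- by move=> a x /andP[a0 _] _; rewrite tmin_ge0// surv_ge0.
apply: eq_integral => x _; apply: (distortion_integral dg cg mg).
by rewrite surv_ge0// surv_le1.
Qed.

(** At each (a, x), [lev] selects one of two values of which [tmin] is the minimum. *)
Lemma distorted_exp_le_dual X Z : measurable_fun setT X -> (forall w, 0 <= X w) ->
  L1plus mu Z -> (distorted_exp P g X <= \int[P]_w Ufun mu Z (X w))%E.
Proof.
move=> mX X0 LZ; rewrite integral_Ufun// distorted_expE//.
have ts := surv_tailfun P mX.
apply: le_level_int.
- by apply: mfun2_tmin; exact: tailfun_measurable.
- by apply: measurable_lev; [exact: L1plus_measurable|exact: tailfun_measurable].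
- by move=> a x /andP[a0 _] _; rewrite tmin_ge0// surv_ge0.
- by move=> a x _ _; exact: tmin_le_lev.
Qed.

(** The quantile function selects the smaller of the two values everywhere, so nothing is lost;
    finiteness of the result places it in $L^1$. *)
Lemma dual_attained X : measurable_fun setT X -> (forall w, 0 <= X w) ->
  (distorted_exp P g X < +oo)%E ->
  L1plus0 mu (tail_quantile (surv P X)) /\
  (\int[P]_w Ufun mu (tail_quantile (surv P X)) (X w) = distorted_exp P g X)%E.
Proof.
move=> mX X0 fin; have ts := surv_tailfun P mX.
have le1 : (level_int mu (lev (tail_quantile (surv P X)) (surv P X)) <= distorted_exp P g X)%E.
  rewrite distorted_expE//; apply: le_level_int.
  - by apply: measurable_lev; [exact: tail_quantile_measurable|exact: tailfun_measurable].
  - by apply: mfun2_tmin; exact: tailfun_measurable.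
  - by move=> a x /andP[a0 _] _; apply: lev_ge0 => //; exact: surv_ge0.
  - move=> a x a01 x0; have /andP[a0 _] := a01; rewrite tmin_tang//.
    by apply: lev_tail_quantile => //; exact: surv_le1.
have LZ : L1plus0 mu (tail_quantile (surv P X)).
  apply: (L1plus0_tail_quantile (b := surv P X)) => //.
  - exact: tailfun_measurable.
  - by move=> x _; exact: surv_ge0.
  - exact: le_lt_trans fin.
split => //; apply/eqP; rewrite eq_le distorted_exp_le_dual ?andbT//; last exact: LZ.1.
by rewrite integral_Ufun//; exact: LZ.1.
Qed.

Lemma dual_inf X : measurable_fun setT X -> (forall w, 0 <= X w) ->
  (distorted_exp P g X < +oo)%E ->
  distorted_exp P g X =
  ereal_inf [set (\int[P]_w Ufun mu Z (X w))%E | Z in L1plus0 mu].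
Proof.
move=> mX X0 fin; apply/eqP; rewrite eq_le; apply/andP; split.
  by apply: le_ereal_inf_tmp => _ [Z [LZ _] <-]; exact: distorted_exp_le_dual.
have [LZ e] := dual_attained mX X0 fin.
by rewrite -e; apply: ereal_inf_lbound; exists (tail_quantile (surv P X)).
Qed.

End dual_functional.
(** The filter [t^'+] leaves out [t], which the sequence may hit; at such indices the distance to
    the limit is 0. *)
Lemma right_cvg_seq (R : realType) (f : R -> R) t (u : nat -> R) :
  f s @[s --> t^'+] --> f t -> u n @[n --> \oo] --> t -> (forall n, t <= u n) ->
  f (u n) @[n --> \oo] --> f t.
Proof.
move=> /cvgrPdist_lt cf /cvgrPdist_lt cu tu; apply/cvgrPdist_lt => e e0.
have := cf e e0; rewrite near_withinE => -[r /= r0 Hr].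
apply: filterS (cu r r0) => n h.
have := tu n; rewrite le_eqVlt => /predU1P[<-|tn]; first by rewrite subrr normr0.
exact: Hr.
Qed.

(** * Stopping *)

Section survival_liminf.
Context (R : realType) (d : measure_display) (Omega : measurableType d).
Context (P : probability Omega R).

(** If [x < X w], then [x < Xn k w] for all large [k], so the event lies in the union of the
    increasing [B m]. Strictness is essential; the lower bound is the side that enters Fatou's
    lemma. *)
Lemma surv_liminf (Xn : nat -> Omega -> R) (X : Omega -> R) :
  (forall n, measurable_fun setT (Xn n)) -> measurable_fun setT X ->
  (forall w, Xn n w @[n --> \oo] --> X w) ->
  forall x e, 0 < e -> \forall n \near \oo, surv P X x - e <= surv P (Xn n) x.
Proof.
move=> mXn mX cX x e e0.
pose B m := \bigcap_(k in [set k | (m <= k)%N]) [set w | x < Xn k w].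
have mB m : measurable (B m).
  by apply: bigcap_measurable => [|k _]; [exists m => /=|exact: measurable_gt].
have cvB : pr P (B m) @[m --> \oo] --> pr P (\bigcup_m B m).
  apply: pr_bigcup_cvg => // m n mn; apply/subsetPset => w Bw k /= nk.
  by apply: Bw => /=; exact: leq_trans nk.
have le1 : surv P X x <= pr P (\bigcup_m B m).
  rewrite survE//; apply: le_pr; [exact: measurable_gt|exact: bigcup_measurable|].
  move=> w /= xX; have /cvgrPdist_lt/(_ (X w - x)) := cX w.
  rewrite subr_gt0 => /(_ xX) [m _ Hm]; exists m => // k /= /Hm /= /ltr_normlW.
  by lra.
move/cvgrPdist_lt : cvB => /(_ _ e0); apply: filterS => n /ltr_normlW h.
rewrite (survE P x (mXn n)).
have : pr P (B n) <= pr P [set w | x < Xn n w].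
  by apply: le_pr => //; [exact: measurable_gt|move=> w; apply => /=].
by lra.
Qed.

End survival_liminf.

Section stopping.
Context (R : realType) (d : measure_display) (Omega : measurableType d).
Context (T : R) (F : R -> set (set Omega)) (Y : R -> Omega -> R).
Hypotheses (T0 : 0 < T) (fF : filtration T F).

Let sF t : 0 <= t <= T -> sigma_algebra setT (F t).
Proof. by move=> tT; apply: (fF.1 t _).1; rewrite in_itv. Qed.

Let FM t : 0 <= t <= T -> F t `<=` measurable.
Proof. by move=> tT; apply: (fF.1 t _).2; rewrite in_itv. Qed.

Let gF t : 0 <= t <= T -> (F t).-sigma.-measurable = F t.
Proof. by move=> tT; apply: measurable_g_measurableTypeE; exact: sF. Qed.

Lemma stopping_time_cst t : 0 <= t <= T -> stopping_times T F (fun=> t).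
Proof.
move=> tT; split; first by move=> w; rewrite in_itv.
move=> u; rewrite in_itv/= => uT; rewrite -gF//.
have [tu|ut] := leP t u.
  by rewrite (_ : [set w | true] = setT)//; exact/seteqP.
by rewrite (_ : [set w | false] = set0)//; apply/seteqP; split.
Qed.

(** Delaying both times to [s] makes the choice known when it is used: before [s] nothing has
    stopped, and from [s] on [A] belongs to the sigma-algebra. *)
Lemma stopping_time_switch tau1 tau2 s (A : set Omega) : 0 <= s <= T -> F s A ->
  stopping_times T F tau1 -> stopping_times T F tau2 ->
  stopping_times T F
    (fun w => if w \in A then Num.max (tau2 w) s else Num.max (tau1 w) s).
Proof.
move=> sT FA [t1 st1] [t2 st2]; have /andP[s0 sT'] := sT.
split.
  move=> w; have := t1 w; have := t2 w; rewrite !in_itv/= => /andP[? ?] /andP[? ?].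
  by case: ifP => _; rewrite le_max s0 orbT/= ge_max sT' andbT.
move=> u uI; move: (uI); rewrite in_itv/= => uT.
have [us|su] := ltP u s.
  rewrite (_ : [set w | _] = set0); first by rewrite -gF//.
  apply/seteqP; split => // w /=; case: ifP => _; rewrite ge_max => /andP[_]; by rewrite leNgt us.
have FAu : F u A by apply: (fF.2 s u) => //; have /andP[] := uT.
have := st1 u uI; have := st2 u uI; rewrite -gF// in FAu * => F2 F1.
rewrite (_ : [set w | _] = (A `&` [set w | tau2 w <= u]) `|` (~` A `&` [set w | tau1 w <= u])).
  by apply: measurableU; apply: measurableI => //; exact: measurableC.
apply/seteqP; split => w /=.
  case: ifP => wA; rewrite ge_max => /andP[h _]; [left|right]; split => //.
    by rewrite inE in wA.
  by move=> /mem_set; rewrite wA.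
move=> [[wA h]|[wA h]]; first by rewrite mem_set// ge_max h.
by rewrite memNset// ge_max h.
Qed.

Lemma stopping_time_max tau s : 0 <= s <= T -> stopping_times T F tau ->
  stopping_times T F (fun w => Num.max (tau w) s).
Proof.
move=> sT st; have F0 : F s set0 by rewrite -gF.
have := stopping_time_switch sT F0 st st.
by congr (stopping_times _ _ _); apply/funext => w; rewrite in_set0.
Qed.

Lemma stopping_time_measurable tau : stopping_times T F tau -> measurable_fun setT tau.
Proof.
move=> [t1 st1]; apply: (measurability (@RGenOInfty.G R)) => [|/= _ [_] [r] -> <-].
  exact: RGenOInfty.measurableE.
rewrite setTI (_ : _ @^-1` _ = ~` [set w | tau w <= r]); last first.
  apply/seteqP; split => w /=; rewrite in_itv/= andbT ltNge; first by move/negP.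
  by move/negP.
apply: measurableC.
have [r0|r0] := ltP r 0.
  rewrite (_ : [set w | _] = set0)//; apply/seteqP; split => // w /=.
  by have := t1 w; rewrite in_itv/= => /andP[? _]; rewrite leNgt (lt_le_trans r0).
have [rT|Tr] := leP r T; first by apply: (@FM r); [rewrite r0|apply: st1; rewrite in_itv/= r0].
rewrite (_ : [set w | _] = setT)//; apply/seteqP; split => // w _ /=.
by have := t1 w; rewrite in_itv/= => /andP[_ /le_trans]; apply; exact: ltW.
Qed.

Hypotheses (aY : adapted T F Y) (rY : right_continuous_paths T Y).

(** [tau] is approximated from the right by times on a grid. On each cell the stopped value is that
    of one fixed [Y (tk n j)], and right-continuity of the paths gives the limit. *)
Lemma stopped_measurable tau : stopping_times T F tau ->
  measurable_fun setT (stopped Y tau).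
Proof.
move=> st; have mt := stopping_time_measurable st; have [t1 _] := st.
pose dl (n : nat) : R := n.+1%:R^-1.
have dl0 n : 0 < dl n by rewrite invr_gt0.
pose k n w := Num.truncn (tau w / dl n).
(* The right end of the cell, hence j + 1, so that [tau] is approached from the right. The cap makes
   it equal to T where [tau] is T, since right-continuity is assumed only before T. *)
pose tk n (j : nat) := Num.min T (j.+1%:R * dl n).
pose Xn n w := Y (tk n (k n w)) w.
have tkI n j : tk n j \in `[0, T].
  by rewrite in_itv/= le_min (ltW T0) mulr_ge0 ?(ltW (dl0 n))//= ge_min lexx.
have tau0 w : 0 <= tau w by have := t1 w; rewrite in_itv/= => /andP[].
have tauT w : tau w <= T by have := t1 w; rewrite in_itv/= => /andP[].
have kE n w j : (k n w == j) = (j%:R * dl n <= tau w < j.+1%:R * dl n).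
  rewrite /k -ler_pdivlMr// -ltr_pdivrMr// truncn_eq//.
  by rewrite divr_ge0// ltW.
have mXn n : measurable_fun setT (Xn n).
  move=> _ B mB; rewrite setTI.
  rewrite (_ : _ @^-1` _ = \bigcup_j ((tau @^-1` `[j%:R * dl n, j.+1%:R * dl n[) `&`
    (Y (tk n j) @^-1` B))); last first.
    apply/seteqP; split => w.
      move=> /= Bw; exists (k n w) => //; split => //=.
      by rewrite in_itv/= -kE.
    by move=> [j _ [/=]]; rewrite in_itv/= -kE => /eqP kj; rewrite /Xn kj.
  apply: bigcup_measurable => j _; apply: measurableI.
    by rewrite -[X in measurable X]setTI; apply: mt.
  apply: (@FM (tk n j)); first by have := tkI n j; rewrite in_itv.
  exact: aY.
have tkgt n w : tau w < tk n (k n w) \/ (tau w = T /\ tk n (k n w) = T).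
  have : k n w == k n w := eqxx _.
  rewrite kE => /andP[_ h].
  have [tT|tT] := ltP (tau w) T; first by left; rewrite lt_min tT.
  have tE : tau w = T by apply/eqP; rewrite eq_le tauT.
  by right; split=> //; apply/min_idPl; rewrite -tE ltW.
apply: (measurable_fun_cvg (h := Xn)) => // w _.
have [tT|tT] := ltP (tau w) T; last first.
  have tE : tau w = T by apply/eqP; rewrite eq_le tauT.
  apply: cvg_near_cst; apply: nearW => n /=; rewrite /Xn /stopped.
  by case: (tkgt n w) => [|[-> ->]//]; rewrite tE lt_min ltxx.
apply: (right_cvg_seq (f := Y ^~ w) (u := fun n => tk n (k n w))).
- by apply: rY; rewrite in_itv/= tau0.
- apply/cvgrPdist_lt => e e0.
  have cdl : dl n @[n --> \oo] --> 0 by exact: cvg_harmonic.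
  move/cvgrPdist_lt : cdl => /(_ _ e0); apply: filterS => n.
  rewrite sub0r normrN => /ltr_normlW dle; rewrite distrC ltr_norml.
  have le1 : tk n (k n w) <= tau w + dl n.
    rewrite /tk ge_min; apply/orP; right; rewrite -natr1 mulrDl mul1r lerD2r.
    have : k n w == k n w := eqxx _.
    by rewrite kE => /andP[].
  have ge1 : tau w <= tk n (k n w).
    by case: (tkgt n w) => [/ltW//|[-> ->]].
  by apply/andP; split; lra.
- by move=> n; case: (tkgt n w) => [/ltW//|[-> ->]].
Qed.

(** Where [tau] is positive the sequence is eventually constant; where it is 0, the paths are
    right-continuous at 0. *)
Lemma stopped_max_cvg tau : stopping_times T F tau -> forall w,
  stopped Y (fun w => Num.max (tau w) (T / n.+1%:R)) w @[n --> \oo] --> stopped Y tau w.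
Proof.
move=> [t1 _] w; rewrite /stopped.
have := t1 w; rewrite in_itv/= le_eqVlt => /andP[/predU1P[t0 _|t0 tT]].
  rewrite -t0; under eq_fun do rewrite (max_idPr _) ?divr_ge0 ?(ltW T0)//.
  apply: (right_cvg_seq (f := Y ^~ w) (u := fun n => T / n.+1%:R)).
  - by apply: rY; rewrite in_itv/= lexx T0.
  - have : T * n.+1%:R^-1 @[n --> \oo] --> T * 0.
      by apply: cvgM; [exact: cvg_cst|exact: cvg_harmonic].
    by rewrite mulr0.
  - by move=> n; rewrite divr_ge0// ltW.
apply: cvg_near_cst; near=> n; congr (Y _ w); apply/max_idPl.
have : n.+1%:R^-1 < tau w / T :> R.
  near: n.
  have cdl : n.+1%:R^-1 @[n --> \oo] --> (0 : R) by exact: cvg_harmonic.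
  move/cvgrPdist_lt : cdl => /(_ (tau w / T)); rewrite divr_gt0// => /(_ isT).
  by apply: filterS => n; rewrite sub0r normrN => /ltr_normlW.
by rewrite ltr_pdivlMr// mulrC => /ltW.
Unshelve. all: by end_near. Qed.

End stopping.
(** * The minimax argument *)

Section limn_einf_bounds.
Local Open Scope ereal_scope.
Context (R : realType).

Lemma limn_einf_ge (u : (\bar R)^nat) (c : R) :
  (forall e : R, (0 < e)%R -> \forall n \near \oo, (c - e)%:E <= u n) ->
  c%:E <= limn_einf u.
Proof.
move=> cu; rewrite limn_einf_lim (cvg_lim _ (@cvg_einfs_sup _ u))//.
apply/lee_addgt0Pr => e e0; have [n _ Hn] := cu e e0.
rewrite -leeBlDr// -EFinB.
apply: (@le_trans _ _ (einfs u n)); last by apply: ereal_sup_ubound; exists n.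
by apply: le_ereal_inf_tmp => _ [k /= nk <-]; exact: Hn.
Qed.

Lemma limn_einf_le (u : (\bar R)^nat) M : (forall n, u n <= M) -> limn_einf u <= M.
Proof.
move=> uM; rewrite limn_einf_lim (cvg_lim _ (@cvg_einfs_sup _ u))//.
apply: ge_ereal_sup => _ [n _ <-]; apply: (@le_trans _ _ (u n)) => //.
by apply: ereal_inf_lbound; exists n => /=.
Qed.

End limn_einf_bounds.

(** * Averages over dilated levels *)

Section multilevel.
Context (R : realType) (mu : probability (measurableTypeR R) R).
Context (N : nat) (q : R).
Hypothesis q0 : 0 < q.
Implicit Types (a x y : R) (s : R -> R).

(** Each summand equals min (x / a) (q ^ j.+1): the initial slope is that of [tmin a], the kink
    moves from [a] to [a] times q ^ j.+1. Levels start at 1 so that the telescoping has a neighbour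
    below. *)
Definition multi_tmin a x : R := \sum_(j < N) q ^+ j.+1 * tmin a (x / q ^+ j.+1).

Let qj0 j : 0 < q ^+ j. Proof. exact: exprn_gt0. Qed.

Lemma multi_tmin_ge0 a x : 0 < a -> 0 <= x -> 0 <= multi_tmin a x.
Proof.
move=> a0 x0; apply: sumr_ge0 => j _.
by rewrite mulr_ge0 ?(ltW (qj0 _))// tmin_ge0// divr_ge0// ltW.
Qed.

Lemma le_multi_tmin a : 0 < a -> {homo multi_tmin a : x y / x <= y}.
Proof.
move=> a0 x y xy; apply: ler_sum => j _.
by rewrite ler_pM2l// le_tmin// ler_pM2r// invr_gt0.
Qed.

Lemma multi_tmin_lipschitz a x y : 0 < a ->
  multi_tmin a x <= multi_tmin a y + N%:R * (a^-1 * `|x - y|).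
Proof.
move=> a0.
apply: (@le_trans _ _ (\sum_(j < N) (q ^+ j.+1 * tmin a (y / q ^+ j.+1) + a^-1 * `|x - y|))).
  apply: ler_sum => j _.
  have h := @tmin_lipschitz _ a (x / q ^+ j.+1) (y / q ^+ j.+1) a0.
  rewrite -(ler_pM2l (qj0 j.+1)) in h; apply: (le_trans h).
  rewrite mulrDr lerD2l -mulrBl normrM (gtr0_norm (x := _^-1)) ?invr_gt0//.
  by rewrite mulrCA [q ^+ _ * _]mulrC divfK ?gt_eqF.
by rewrite big_split/= sumr_const card_ord mulr_natl.
Qed.

Lemma mfun2_multi_tmin s : tailfun s -> mfun2 (fun a x => multi_tmin a (s x)).
Proof.
move=> ts; apply: (@mfun2_sum _ N (fun j a x => q ^+ j.+1 * tmin a (s x / q ^+ j.+1))) => j.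
apply: measurable_funM; first exact: measurable_cst.
apply: (@mfun2_tmin _ (fun x => s x / q ^+ j.+1)).
by apply: measurable_funM => //; exact: tailfun_measurable.
Qed.

(** Lower bounds on the approximating tails become lower bounds on the integrands, because
    [multi_tmin] is monotone and Lipschitz in the tail. *)
Lemma fatou_multi_tmin (sn : nat -> R -> R) s M :
  (forall n, tailfun (sn n)) -> tailfun s ->
  (forall x e, 0 <= x -> 0 < e -> \forall n \near \oo, s x - e <= sn n x) ->
  (forall n, (level_int mu (fun a x => multi_tmin a (sn n x)) <= M)%E) ->
  (level_int mu (fun a x => multi_tmin a (s x)) <= M)%E.
Proof.
move=> tsn ts liminf snM.
have s0 x : 0 <= x -> 0 <= s x by case: ts => + _ _ _; exact.
have sn0 n x : 0 <= x -> 0 <= sn n x by case: (tsn n) => + _ _ _; exact.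
have mU n := mfun2_multi_tmin (tsn n).
apply: le_trans (limn_einf_le snM).
apply: le_trans; last apply: fatou.
- apply: ge0_le_integral.
  + exact: mDom.
  + by move=> z /DomP[/andP[a0 _] x0]; rewrite lee_fin multi_tmin_ge0// s0.
  + by apply/measurable_EFinP; exact: mfun2_multi_tmin.
  + apply: measurableT_comp => //; apply: measurable_fun_limn_esup => n.
    by apply: measurableT_comp => //; apply/measurable_EFinP; exact: mU.
  + move=> z /DomP[/andP[a0 _] x0]; apply: limn_einf_ge => e e0.
    (* The tolerance absorbs the Lipschitz constant N / a; N + 1 avoids a division by zero. *)
    have e1 : 0 < e * z.1 / N.+1%:R by rewrite divr_gt0// mulr_gt0.
    apply: filterS (liminf _ _ x0 e1) => n h; rewrite lee_fin lerBlDr.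
    apply: le_trans (_ : multi_tmin z.1 (s z.2 - e * z.1 / N.+1%:R) + e <= _).
      have := @multi_tmin_lipschitz z.1 (s z.2) (s z.2 - e * z.1 / N.+1%:R) a0.
      move/le_trans; apply; rewrite lerD2l opprB addrC subrK gtr0_norm//.
      have -> : N%:R * (z.1^-1 * (e * z.1 / N.+1%:R)) = e * (N%:R / N.+1%:R) * (z.1 * z.1^-1).
        by move: (N.+1%:R^-1) (z.1^-1) N%:R => k i l; lra.
      rewrite divff ?gt_eqF// mulr1 ler_piMr ?(ltW e0)// ler_pdivrMr// mul1r.
      by rewrite ler_nat.
    by rewrite lerD2r le_multi_tmin.
- exact: mDom.
- by move=> n; apply/measurable_EFinP; exact: mU.
- by move=> n z /DomP[/andP[a0 _] x0]; rewrite lee_fin multi_tmin_ge0// sn0.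
Qed.

End multilevel.

Section mixture.
Context (R : realType) (d : measure_display) (Omega : measurableType d).
Context (P : probability Omega R) (mu : probability (measurableTypeR R) R).
Context (T : R) (F : R -> set (set Omega)) (Y : R -> Omega -> R).
Hypotheses (T0 : 0 < T) (fF : filtration T F).
Hypotheses (aY : adapted T F Y) (rY : right_continuous_paths T Y).
Hypothesis atF : forall t, t \in `]0, T] -> atomless_on P (F t).

Local Notation S tau := (surv P (stopped Y tau)).

(** An upper bound known for stopping times is carried through two limits, in [n] for the mixing and
    in [m] for the delay T / (m + 1); lower semicontinuity is the right tool for both. *)
Lemma multi_tmin_mixture (N : nat) (q t : R) (b : R -> R) (M : \bar R) tau1 tau2 :
  0 < q -> 0 <= t <= 1 -> tailfun b ->
  (forall tau, stopping_times T F tau ->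
    (level_int mu (fun a x => multi_tmin N q a (S tau x + b x)) <= M)%E) ->
  stopping_times T F tau1 -> stopping_times T F tau2 ->
  (level_int mu (fun a x => multi_tmin N q a ((1 - t) * S tau1 x + t * S tau2 x + b x)) <= M)%E.
Proof.
move=> q0 t01 tb HM st1 st2; have /andP[t0 t1] := t01.
have t1' : 0 <= 1 - t by lra.
have mS tau : stopping_times T F tau -> measurable_fun setT (stopped Y tau).
  exact: (stopped_measurable T0 fF aY rY).
have tS tau : stopping_times T F tau -> tailfun (S tau).
  by move=> st; apply: surv_tailfun; exact: mS.
have tmix ta tb' : stopping_times T F ta -> stopping_times T F tb' ->
    tailfun (fun x => (1 - t) * S ta x + t * S tb' x + b x).
  move=> sa sb; apply: tailfunD => //; apply: tailfunD; apply: tailfunZ => //; exact: tS.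
pose sm (m : nat) := T / m.+1%:R.
have sm0 m : 0 < sm m by rewrite divr_gt0.
have smT m : sm m <= T by rewrite ler_pdivrMr// ler_peMr ?(ltW T0)// ler1n.
have smI m : 0 <= sm m <= T by rewrite smT ltW.
pose u1 m w := Num.max (tau1 w) (sm m).
pose u2 m w := Num.max (tau2 w) (sm m).
have su1 m : stopping_times T F (u1 m) by exact: (stopping_time_max fF (smI m)).
have su2 m : stopping_times T F (u2 m) by exact: (stopping_time_max fF (smI m)).
have step1 m : (level_int mu (fun a x => multi_tmin N q a
    ((1 - t) * S (u1 m) x + t * S (u2 m) x + b x)) <= M)%E.
  have smI' : sm m \in `[0, T] by rewrite in_itv/= smI.
  have smI'' : sm m \in `]0, T] by rewrite in_itv/= sm0 smT.
  have [A [FA mixA]] := mixing_sequence (fF.1 _ smI').1 (fF.1 _ smI').2 (atF smI'') t01.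
  have mA n : measurable (A n) by exact: (fF.1 _ smI').2.
  pose sg n w := if w \in A n then u2 m w else u1 m w.
  have ssg n : stopping_times T F (sg n) by exact: (stopping_time_switch fF (smI m) (FA n) st1 st2).
  pose B tau x := [set w | x < stopped Y tau w].
  have mB tau x : stopping_times T F tau -> measurable (B tau x).
    by move=> st; apply: measurable_gt; exact: mS.
  (* In this form the events besides [A n] do not depend on [n], so that the mixing limit applies to
     both terms. *)
  have Ssg n x : S (sg n) x = S (u1 m) x - pr P (A n `&` B (u1 m) x) + pr P (A n `&` B (u2 m) x).
    rewrite !survE; try exact: mS.
    rewrite -/(B _ x) -/(B (u1 m) x) (prID P (mB _ x (su1 m)) (mA n)).
    rewrite (prID P (mB _ x (ssg n)) (mA n)).
    have -> : B (sg n) x `&` A n = A n `&` B (u2 m) x.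
      apply/seteqP; split => w /=; rewrite /B/= /stopped /sg.
        by move=> [+ Aw]; rewrite mem_set.
      by move=> [Aw]; rewrite mem_set.
    have -> : B (sg n) x `\` A n = B (u1 m) x `\` A n.
      by apply/seteqP; split => w /=; rewrite /B/= /stopped /sg => -[+ Aw]; rewrite memNset.
    by rewrite (setIC (B (u1 m) x)); lra.
  apply: (fatou_multi_tmin q0 (sn := fun n x => S (sg n) x + b x)).
  - by move=> n; apply: tailfunD => //; exact: tS.
  - exact: tmix.
  - move=> x e x0 e0; have e20 : 0 < e / 2 by lra.
    have c1 := mixA _ (mB _ x (su1 m)); have c2 := mixA _ (mB _ x (su2 m)).
    move/cvgrPdist_lt : c1 => /(_ _ e20) c1; move/cvgrPdist_lt : c2 => /(_ _ e20) c2.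
    apply: filterS2 c1 c2 => n; rewrite !ltr_norml => /andP[h1 h2] /andP[h3 h4].
    rewrite Ssg; move: h1 h2 h3 h4.
    rewrite -[pr P (B (u1 m) x)]survE; last exact: mS.
    rewrite -[pr P (B (u2 m) x)]survE; last exact: mS.
    by lra.
  - by move=> n; exact: HM.
apply: (fatou_multi_tmin q0 (sn := fun m x => (1 - t) * S (u1 m) x + t * S (u2 m) x + b x)) => //.
- by move=> m; exact: tmix.
- exact: tmix.
- move=> x e x0 e0.
  have l1 : \forall m \near \oo, S tau1 x - e <= S (u1 m) x.
    apply: surv_liminf => //; [by move=> n; exact: mS|exact: mS|].
    exact: (stopped_max_cvg T0 rY st1).
  have l2 : \forall m \near \oo, S tau2 x - e <= S (u2 m) x.
    apply: surv_liminf => //; [by move=> n; exact: mS|exact: mS|].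
    exact: (stopped_max_cvg T0 rY st2).
  apply: filterS2 l1 l2 => m h1 h2.
  have : (1 - t) * (S tau1 x - e) <= (1 - t) * S (u1 m) x by rewrite ler_wpM2l.
  have : t * (S tau2 x - e) <= t * S (u2 m) x by rewrite ler_wpM2l.
  by lra.
Qed.

End mixture.

(** * Dual variables from a nearly optimal tail *)

Section minimax_levels.
Context (R : realType) (mu : probability (measurableTypeR R) R).
Implicit Types (s : R -> R) (a x k q t : R).

Local Notation G s := (level_int mu (fun a x => tmin a (s x))).
Local Notation K N q s := (level_int mu (fun a x => multi_tmin N q a (s x))).

(** The convex function e |-> (1 + e) ^ n lies below its chord between 0 and 1. *)
Lemma exprn_le_linear (e : R) n : 0 <= e <= 1 -> (1 + e) ^+ n <= 1 + (2 ^+ n - 1) * e.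
Proof.
move=> /andP[e0 e1]; elim: n => [|n ih]; first by rewrite !expr0 subrr mul0r addr0.
rewrite exprS; apply: (@le_trans _ _ ((1 + e) * (1 + (2 ^+ n - 1) * e))).
  by rewrite ler_wpM2l//; lra.
have : 1 <= 2 ^+ n :> R by apply: exprn_ege1; lra.
rewrite exprS; set c := 2 ^+ n => c1.
have : (c - 1) * (e * e) <= (c - 1) * e.
  by rewrite ler_wpM2l ?ler_piMl//; lra.
by lra.
Qed.

Context (SS : set (R -> R)) (sstar : R -> R).
Hypotheses (SS0 : SS !=set0) (tstar : tailfun sstar).
Hypothesis SStail : forall s, SS s -> tailfun s.
Hypothesis SSle1 : forall s x, SS s -> s x <= 1.
Hypothesis SSstar : forall s x, SS s -> s x <= sstar x.
Hypothesis mixSS : forall N q t (b : R -> R) (M : \bar R), 0 < q -> 0 <= t <= 1 -> tailfun b ->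
  (forall s, SS s -> (K N q (fun x => (s x + b x)%R) <= M)%E) ->
  forall s1 s2, SS s1 -> SS s2 ->
  (K N q (fun x => ((1 - t) * s1 x + t * s2 x + b x)%R) <= M)%E.

Variables (v w : R).
Hypothesis Gv : forall s, SS s -> (G s <= v%:E)%E.
Hypothesis Gw : (G sstar <= w%:E)%E.

Let tail_ge0 s x : tailfun s -> 0 <= x -> 0 <= s x.
Proof. by case=> + _ _ _; exact. Qed.

(** The dual variables come from tangents at one nearly optimal tail. The second term of the bound
    does not depend on [N], so it disappears after division by [N] with [k] fixed. *)
Lemma minimax_levels (N : nat) k gk : 0 < k <= 1 ->
  (G (fun x => (k * sstar x)%R) <= gk%:E)%E ->
  exists Z : nat -> R -> R, (forall j, (j < N)%N -> L1plus0 mu (Z j)) /\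
    forall s, SS s -> (\sum_(j < N) level_int mu (lev (Z j) s) <=
      (N%:R * (1 + k) * (v + gk) + (1 + 4 * ((1 + k) / k) * w))%:E)%E.
Proof.
move=> /andP[k0 k1] Gk.
(* By the chord bound this choice makes [q ^ N.+1] at most [1 + k]. *)
pose e : R := k / 2 ^+ N.+1.
have p2 : 0 < 2 ^+ N.+1 :> R by rewrite exprn_gt0.
have e0 : 0 < e by rewrite divr_gt0.
have e1 : e <= 1.
  by rewrite ler_pdivrMr// mul1r; apply: (le_trans k1); apply: exprn_ege1; lra.
pose q := 1 + e.
have q0 : 0 < q by rewrite /q; lra.
have q1 : 1 <= q by rewrite /q; lra.
have qN : q ^+ N.+1 <= 1 + k.
  apply: (le_trans (@exprn_le_linear e N.+1 _)); first by rewrite (ltW e0).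
  have -> : k = 2 ^+ N.+1 * e by rewrite /e mulrC divfK// gt_eqF.
  by rewrite lerD2l ler_wpM2r ?(ltW e0)//; lra.
have qj j : (j <= N.+1)%N -> q ^+ j <= 1 + k.
  by move=> jN; apply: le_trans qN; rewrite ler_weXn2l.
have qj1 j : 1 <= q ^+ j by rewrite exprn_ege1.
have qj0 j : 0 < q ^+ j by rewrite exprn_gt0.
(* For two tails of [SS], s + k sstar <= (1 + k) sstar = C k sstar <= C (s0 + k sstar); this is the
   comparability that the added multiple of [sstar] buys. *)
pose C := (1 + k) / k.
have Ck : C * k = 1 + k by rewrite /C divfK// gt_eqF.
have C1 : 1 <= C by rewrite /C ler_pdivlMr// mul1r; lra.
(* As (C - 1) k = 1, one gets t (C - 1) = e / 2, and t (1 + e) <= e because [k] and [e] are at most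
   1. These are the two conditions on the step in the telescoping lemma. *)
pose t := e * k / 2.
have ek0 : 0 < e * k by rewrite mulr_gt0.
have eke : e * k <= e by rewrite ler_piMr// ltW.
have t0 : 0 < t by rewrite /t; lra.
have t01 : 0 <= t <= 1 by rewrite /t; lra.
have tC : t * (C - 1) <= q - 1.
  have -> : t * (C - 1) = e / 2 * (C * k - k) by rewrite /t; lra.
  by rewrite Ck /q; lra.
have tq : 1 <= (1 - t) * q.
  have : e * k * e <= e * e by rewrite ler_wpM2r// ltW.
  have : e * e <= e by rewrite ler_piMr// ltW.
  by rewrite /q /t; lra.
pose b x := k * sstar x.
have tb : tailfun b by apply: tailfunZ => //; exact: ltW.
pose B : \bar R := (N%:R * (1 + k) * (v + gk))%:E.
have tsb s : SS s -> tailfun (fun x => s x + b x) by move=> Ss; apply: tailfunD => //; exact: SStail.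
(* Dropping the dilation inside [tmin] and bounding the weights by 1 + k compares each level with
   [tmin a (s x + b x)], which subadditivity splits. *)
have KB s : SS s -> (K N q (fun x => (s x + b x)%R) <= B)%E.
  move=> Ss; have ts := SStail Ss.
  apply: (@le_trans _ _ (level_int mu (fun a x => (N%:R * (1 + k) * (tmin a (s x) + tmin a (b x)))%R))).
    apply: le_level_int.
    - by apply: mfun2_multi_tmin; exact: tsb.
    - apply: measurable_funM; first exact: measurable_cst.
      by apply: measurable_funD; apply: mfun2_tmin; exact: tailfun_measurable.
    - move=> a x /andP[a0 _] x0; apply: multi_tmin_ge0 => //.
      exact: (tail_ge0 (tsb _ Ss)).
    - move=> a x /andP[a0 _] x0.
      apply: (@le_trans _ _ (\sum_(j < N) (1 + k) * (tmin a (s x) + tmin a (b x)))).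
        apply: ler_sum => j _.
        have sx0 := tail_ge0 ts x0; have bx0 := tail_ge0 tb x0.
        apply: (@le_trans _ _ (q ^+ j.+1 * (tmin a (s x) + tmin a (b x)))).
          rewrite ler_pM2l//; apply: le_trans (tmin_subadd a0 sx0 bx0).
          apply: le_tmin => //; rewrite ler_pdivrMr// ler_peMr ?addr_ge0//.
        by rewrite ler_wpM2r ?addr_ge0 ?tmin_ge0// qj// ltnS ltnW.
      by rewrite sumr_const card_ord -mulrA [leRHS]mulr_natl.
  rewrite level_intZ; last 3 first.
  - by apply: measurable_funD; apply: mfun2_tmin; exact: tailfun_measurable.
  - by rewrite mulr_ge0//; lra.
  - by move=> a x /andP[a0 _] x0; rewrite addr_ge0 ?tmin_ge0 ?(tail_ge0 ts) ?(tail_ge0 tb).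
  rewrite level_intD; last 4 first.
  - by apply: mfun2_tmin; exact: tailfun_measurable.
  - by apply: mfun2_tmin; exact: tailfun_measurable.
  - by move=> a x /andP[a0 _] x0; rewrite tmin_ge0 ?(tail_ge0 ts).
  - by move=> a x /andP[a0 _] x0; rewrite tmin_ge0 ?(tail_ge0 tb).
  rewrite /B (EFinM (N%:R * (1 + k)) (v + gk)) (EFinD v gk); apply: lee_wpmul2l.
    by rewrite lee_fin mulr_ge0//; lra.
  by apply: leeD => //; exact: Gv.
have K0 s : tailfun s -> (0 <= K N q s)%E.
  move=> ts; apply: level_int_ge0 => a x /andP[a0 _] x0; apply: multi_tmin_ge0 => //.
  exact: tail_ge0.
pose M := ereal_sup [set K N q (fun x => s x + b x) | s in SS].
have MB : (M <= B)%E by apply: ge_ereal_sup => _ [s Ss <-]; exact: KB.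
have KM s : SS s -> (K N q (fun x => (s x + b x)%R) <= M)%E.
  by move=> Ss; apply: ereal_sup_ubound; exists s.
have Mfin : M \is a fin_num.
  rewrite ge0_fin_numE; first by rewrite (le_lt_trans MB)// ltry.
  by have [s Ss] := SS0; apply: (le_trans (K0 _ (tsb _ Ss))); exact: KM.
(* Optimal up to [t] itself: after division by [t] this costs only the constant 1 in the bound. *)
have [_ [s0 Ss0 <-] Ks0] := ub_ereal_sup_adherent t0 Mfin.
rewrite -/M in Ks0.
pose p x := s0 x + b x.
have tp : tailfun p by exact: tsb.
have tpj j : tailfun (fun x => p x / q ^+ j.+1).
  have : tailfun (fun x => (q ^+ j.+1)^-1 * p x).
    by apply: tailfunZ => //; rewrite invr_ge0 ltW.
  by congr tailfun; apply/funext => x; rewrite mulrC.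
(* By [lev_tail_quantile] the cost of [Z j] lies below the tangent of [tmin] at [p / q ^ j.+1]. *)
pose Z j := tail_quantile (fun x => p x / q ^+ j.+1).
have Lam s : SS s -> (\sum_(j < N) level_int mu (lev (Z j) s) <=
      (fine M + (1 + 4 * C * w))%:E)%E.
  move=> Ss; have ts := SStail Ss.
  have s_ge0 x : 0 <= x -> 0 <= s x by exact: tail_ge0.
  pose tg (j : nat) a x := tang a (p x / q ^+ j.+1) (s x).
  have mtg j : mfun2 (tg j).
    by apply: mfun2_tang; exact: tailfun_measurable.
  have tg0 j a x : 0 < a <= 1 -> 0 <= x -> 0 <= tg j a x.
    by move=> /andP[a0 _] x0; rewrite tang_ge0 ?s_ge0.
  apply: (@le_trans _ _ (\sum_(j < N) level_int mu (tg j))%E).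
    apply: lee_sum => j _; apply: le_level_int => //.
    - apply: measurable_lev; [exact: tail_quantile_measurable|exact: tailfun_measurable].
    - by move=> a x /andP[a0 _] x0; rewrite lev_ge0 ?s_ge0.
    - move=> a x a01 x0; apply: (@lev_tail_quantile _ _ s) => //; exact: SSle1.
  rewrite -level_int_sum//.
  set L := level_int mu _.
  pose mx x := (1 - t) * s0 x + t * s x + b x.
  have tmx : tailfun mx.
    have ts0 := SStail Ss0.
    by apply: tailfunD => //; apply: tailfunD; apply: tailfunZ => //; lra.
  have Kmx : (K N q mx <= M)%E by apply: mixSS => //.
  have tC0 : 0 <= t * (4 * C) by apply: mulr_ge0; [exact: ltW|lra].
  (* The telescoping inequality, integrated. The moved point is [mx], whose value is at most [M]
     although it need not come from a stopping time. *)
  have main : (t%:E * L + K N q p <= t%:E * K N q p + K N q mx + (t * (4 * C))%:E * G sstar)%E.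
    have mL : mfun2 (fun a x => \sum_(j < N) tg j a x) by exact: mfun2_sum.
    have mp : mfun2 (fun a x => multi_tmin N q a (p x)) by exact: mfun2_multi_tmin.
    have mmx : mfun2 (fun a x => multi_tmin N q a (mx x)) by exact: mfun2_multi_tmin.
    have mst : mfun2 (fun a x => tmin a (sstar x)) by apply: mfun2_tmin; exact: tailfun_measurable.
    have pL a x : 0 < a <= 1 -> 0 <= x -> 0 <= \sum_(j < N) tg j a x.
      by move=> a01 x0; apply: sumr_ge0 => j _; exact: tg0.
    have pp a x : 0 < a <= 1 -> 0 <= x -> 0 <= multi_tmin N q a (p x).
      by move=> /andP[a0 _] x0; apply: multi_tmin_ge0 => //; exact: tail_ge0.
    have pmx a x : 0 < a <= 1 -> 0 <= x -> 0 <= multi_tmin N q a (mx x).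
      by move=> /andP[a0 _] x0; apply: multi_tmin_ge0 => //; exact: tail_ge0.
    have pst a x : 0 < a <= 1 -> 0 <= x -> 0 <= tmin a (sstar x).
      by move=> /andP[a0 _] x0; apply: tmin_ge0 => //; exact: tail_ge0.
    have mZ c f : mfun2 f -> mfun2 (fun a x => c * f a x : R).
      by move=> mf; apply: measurable_funM => //; exact: measurable_cst.
    have pZ c f : 0 <= c -> (forall a x, 0 < a <= 1 -> 0 <= x -> 0 <= f a x) ->
        forall a x, 0 < a <= 1 -> 0 <= x -> 0 <= c * f a x :> R.
      by move=> c0 f0 a x a01 x0; rewrite mulr_ge0 ?f0.
    have t0' := ltW t0.
    rewrite /L -!level_intZ// -!level_intD//; try exact: mZ; try exact: pZ; last 2 first.
    - by apply: mfun2D => //; exact: mZ.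
    - by move=> a x a01 x0; rewrite addr_ge0 ?pmx// mulr_ge0 ?pp.
    apply: le_level_int.
    - by apply: mfun2D => //; exact: mZ.
    - by apply: mfun2D; [apply: mfun2D => //; exact: mZ|exact: mZ].
    - by move=> a x a01 x0; rewrite addr_ge0 ?pp// mulr_ge0 ?pL.
    - move=> a x a01 x0; have /andP[a0 _] := a01.
      have sx0 := s_ge0 _ x0; have bx0 := tail_ge0 tb x0.
      have s0x0 := tail_ge0 (SStail Ss0) x0; have stx0 := tail_ge0 tstar x0.
      have sC : s x + b x <= C * p x.
        have h1 := SSstar x Ss.
        have h2 : C * b x <= C * p x.
          have C0 : 0 <= C by lra.
          by apply: ler_wpM2l => //; rewrite /p lerDr.
        have h3 : C * b x = (1 + k) * sstar x by rewrite -Ck /b mulrA.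
        by move: h2 h3; rewrite /b; lra.
      have := @tang_telescope R a N (p x) (s x + b x) (s x) t q C a0 (tail_ge0 tp x0)
        (addr_ge0 sx0 bx0) sC C1.
      rewrite lerDl => /(_ bx0 t0' q1 tC tq).
      have -> : p x + t * (s x + b x - p x) = mx x by rewrite /p /mx; lra.
      (* The factor 4 is a product of two bounds by 2: [q ^ N.+1 <= 1 + k <= 2], and p <= (1 + k)
         sstar <= 2 sstar. *)
      move=> /le_trans; apply; rewrite lerD2l -[t * (4 * C) * _]mulrA ler_wpM2l//.
      rewrite (_ : 4 * C * _ = C * (4 * tmin a (sstar x))); last by lra.
      rewrite -mulrA; apply: ler_wpM2l; first by lra.
      apply: (@le_trans _ _ (q ^+ N.+1 * tmin a (2 * sstar x))).
        rewrite ler_pM2l// le_tmin// ler_pdivrMr//.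
        have h1 := SSstar x Ss0.
        have h2 : k * sstar x <= sstar x by rewrite ler_piMl.
        have h3 : 2 * sstar x <= 2 * sstar x * q ^+ N.+1 by rewrite ler_peMr ?mulr_ge0.
        by rewrite /p /b; lra.
      apply: (@le_trans _ _ (q ^+ N.+1 * (2 * tmin a (sstar x)))).
        by rewrite ler_pM2l// tmin_homog_le// ler1n.
      rewrite mulrA ler_wpM2r ?tmin_ge0//; have := qN; lra.
  have Kp : (K N q p <= M)%E by exact: KM.
  have Kpfin : K N q p \is a fin_num.
    by rewrite ge0_fin_numE ?K0// (le_lt_trans Kp)// (le_lt_trans MB)// ltry.
  move: main Kp Ks0; rewrite -/p -(fineK Kpfin) -(fineK Mfin).
  set m := fine M; set kp := fine _ => main Kp Ks0.
  have {}main : (t%:E * L + kp%:E <= (t * kp + m + t * (4 * C) * w)%:E)%E.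
    apply: (le_trans main); rewrite !EFinD !EFinM; apply: leeD.
      by apply: leeD => //; rewrite (fineK Mfin).
    by apply: lee_wpmul2l => //; rewrite lee_fin.
  rewrite -EFinB lte_fin in Ks0; rewrite lee_fin in Kp.
  have L0 : (0 <= L)%E by apply: level_int_ge0 => a x a01 x0; apply: sumr_ge0 => j _; exact: tg0.
  (* For a real [L], near-optimality of [p] cancels the leading [m] and a division by [t] remains;
     an infinite [L] contradicts the finite right-hand side. *)
  move: main; case: L L0 => [l _| |]//=.
    rewrite -EFinM -EFinD !lee_fin => main.
    have h : t * kp <= t * m by rewrite ler_pM2l.
    rewrite -(ler_pM2l t0); lra.
  by rewrite gt0_muley ?lte_fin// addye.
exists Z; split.
  (* The bound at the single tail [s0] already makes each cost finite. *)
  move=> j jN; apply: (@L1plus0_tail_quantile _ _ _ s0) => //.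
  - exact: tailfun_measurable (SStail Ss0).
  - by move=> x; exact: tail_ge0 (SStail Ss0).
  apply: le_lt_trans (ltry (fine M + (1 + 4 * C * w))).
  apply: le_trans (Lam _ Ss0).
  rewrite (bigD1 (Ordinal jN))//= leeDl// sume_ge0// => i _.
  apply: level_int_ge0 => a x /andP[a0 _] x0; rewrite lev_ge0//.
  exact: tail_ge0 (SStail Ss0) _.
move=> s Ss; apply: (le_trans (Lam _ Ss)); rewrite lee_fin lerD2r.
by move: MB; rewrite -(fineK Mfin) lee_fin.
Qed.

End minimax_levels.

(** * Small multiples of a tail *)

Section vanishing_scale.
Context (R : realType) (mu : probability (measurableTypeR R) R).

(** The integrand is dominated by its value at scale 1 and is at most s x / (a (n + 1)). This makes
    the price of the added multiple of the tail of $Y^*$ as small as desired. *)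
Lemma level_int_tmin_scale_cvg0 (s : R -> R) : tailfun s ->
  (level_int mu (fun a x => tmin a (s x)) < +oo)%E ->
  (level_int mu (fun a x => tmin a (n.+1%:R^-1 * s x)) @[n --> \oo] --> 0)%E.
Proof.
move=> ts fin.
have s0 x : 0 <= x -> 0 <= s x by case: ts => + _ _ _; exact.
have tsn n : tailfun (fun x => n.+1%:R^-1 * s x) by apply: tailfunZ.
have mn n : mfun2 (fun a x => tmin a (n.+1%:R^-1 * s x)).
  by apply: mfun2_tmin; exact: tailfun_measurable.
have ms : mfun2 (fun a x => tmin a (s x)) by apply: mfun2_tmin; exact: tailfun_measurable.
have lesn n x : 0 <= x -> n.+1%:R^-1 * s x <= s x.
  by move=> x0; rewrite ler_piMl ?s0// invf_le1 ?ltr0Sn// ler1n.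
have sn0 n x : 0 <= x -> 0 <= n.+1%:R^-1 * s x by move=> x0; rewrite mulr_ge0 ?s0.
rewrite -(integral0 (mu \x lebesgue_measure)%E (`]0, 1]%classic `*` `[0, +oo[%classic :
  set (measurableTypeR R * measurableTypeR R))).
apply: (dominated_cvg (@mDom R) (g := fun z : measurableTypeR R * measurableTypeR R =>
  (tmin z.1 (s z.2))%:E)).
- by move=> n; apply/measurable_EFinP; exact: mn.
- move=> z /DomP[/andP[a0 _] x0]; apply: cvg_EFin; first by apply: nearW.
  apply: (@squeeze_cvgr _ _ _ _ (fun=> 0) (fun n => n.+1%:R^-1 * (s z.2 / z.1))).
  + apply: nearW => n; rewrite /= tmin_ge0 ?sn0//=.
    by rewrite mulrA /tmin ge_min lexx.
  + exact: cvg_cst.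
  + rewrite -[X in _ --> X](mul0r (s z.2 / z.1)); apply: cvgM; last exact: cvg_cst.
    exact: cvg_harmonic.
- by [].
- apply/integrableP; split; first by apply/measurable_EFinP; exact: ms.
  apply: le_lt_trans fin; rewrite /level_int le_eqVlt; apply/orP; left; apply/eqP.
  apply: eq_integral => z; rewrite inE => /DomP[/andP[a0 _] x0].
  by rewrite /= ger0_norm// tmin_ge0// s0.
- move=> n z /DomP[/andP[a0 _] x0]; rewrite /= lee_fin ger0_norm ?tmin_ge0 ?sn0//.
  by apply: le_tmin => //; exact: lesn.
Qed.

End vanishing_scale.

(** * Convexity of the cost in the dual variable *)

Section averaging.
Context (R : realType) (d : measure_display) (Omega : measurableType d).
Context (P : probability Omega R) (mu : probability (measurableTypeR R) R).
Implicit Types (X : Omega -> R) (Z : R -> R).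

Local Notation I1 := (`]0, 1]%classic : set R).

Let mI1 : measurable (I1 : set (measurableTypeR R)).
Proof. exact: measurable_itv. Qed.

Definition cost Z (y a : R) : R := Num.max (y - Z a) 0 / a + Z a.

Lemma cost_ge0 Z y a : L1plus mu Z -> a \in `]0, 1] -> 0 <= cost Z y a.
Proof.
move=> [_ Z0] aI; move: (aI); rewrite in_itv/= => /andP[a0 _].
by rewrite addr_ge0 ?Z0// divr_ge0 ?(ltW a0)// le_max lexx orbT.
Qed.

Lemma measurable_cost Z y : L1plus mu Z ->
  measurable_fun (I1 : set (measurableTypeR R)) (cost Z y).
Proof.
move=> LZ; have mZ := L1plus_measurable LZ.
apply: measurable_funD => //; apply: measurable_funM; last exact: measurable_inv_itv01.
apply: measurable_maxr; last exact: measurable_cst.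
by apply: measurable_funB => //; exact: measurable_cst.
Qed.

Lemma measurable_Ufun X Z : measurable_fun setT X -> L1plus mu Z ->
  measurable_fun setT (fun w => Ufun mu Z (X w)).
Proof.
move=> mX LZ.
apply: (@measurable_integral_section1 _ _ _ _ R mu setT I1
  (fun q : Omega * measurableTypeR R => (cost Z (X q.1) q.2)%:E)) => //.
- apply/measurable_EFinP; apply: measurable_Ufun_integrand => //.
  exact: L1plus_measurable LZ.
- by move=> w a _ aI; rewrite lee_fin; apply: cost_ge0.
Qed.

Lemma Ufun_ge0 Z y : L1plus mu Z -> (0 <= Ufun mu Z y)%E.
Proof. by move=> LZ; apply: integral_ge0 => a aI; rewrite lee_fin; exact: cost_ge0. Qed.

Definition average (N : nat) (Z : nat -> R -> R) (a : R) : R := N%:R^-1 * \sum_(j < N) Z j a.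

Lemma L1plus0_average N (Z : nat -> R -> R) :
  (forall j, L1plus0 mu (Z j)) -> L1plus0 mu (average N Z).
Proof.
move=> LZ; split; last first.
  by rewrite /average big1 ?mulr0// => j _; exact: (LZ j).2.
split; last first.
  move=> a aI; rewrite mulr_ge0// sumr_ge0// => j _.
  exact: (LZ j).1.2.
rewrite (_ : _ \o _ = (fun a => N%:R^-1%:E * \sum_(j < N) (Z j a)%:E)%E); last first.
  by apply/funext => a /=; rewrite EFinM sumEFin.
apply: integrableZl => //; apply: integrable_sum => // j _.
exact: (LZ j).1.1.
Qed.

(** z |-> (y - z)^+ is convex, and the remaining term is linear. *)
Lemma cost_average N (Z : nat -> R -> R) y a : (0 < N)%N -> 0 < a ->
  cost (average N Z) y a <= N%:R^-1 * \sum_(j < N) cost (Z j) y a.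
Proof.
move=> N0 a0; have N0' : 0 < N%:R :> R by rewrite ltr0n.
rewrite /cost big_split/= mulrDr lerD2r -mulr_suml mulrA ler_pM2r ?invr_gt0//.
rewrite ge_max; apply/andP; split; last first.
  by rewrite mulr_ge0 ?invr_ge0 ?(ltW N0')// sumr_ge0// => j _; rewrite le_max lexx orbT.
rewrite -(ler_pM2l N0') mulVKf ?gt_eqF// /average mulrBr mulVKf ?gt_eqF//.
have -> : N%:R * y = \sum_(j < N) y by rewrite sumr_const card_ord mulr_natl.
by rewrite -sumrB; apply: ler_sum => j _; rewrite le_max lexx.
Qed.

Lemma integral_Ufun_average N (Z : nat -> R -> R) X : (0 < N)%N -> (forall j, L1plus0 mu (Z j)) ->
  measurable_fun setT X ->
  (\int[P]_w Ufun mu (average N Z) (X w) <=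
   N%:R^-1%:E * \sum_(j < N) \int[P]_w Ufun mu (Z j) (X w))%E.
Proof.
move=> N0 LZ mX; have LA := L1plus0_average N LZ.
have iN0 : 0 <= N%:R^-1 :> R by rewrite invr_ge0.
have U y : (Ufun mu (average N Z) y <= N%:R^-1%:E * \sum_(j < N) Ufun mu (Z j) y)%E.
  apply: (@le_trans _ _ (\int[mu]_(a in I1) (N%:R^-1%:E * \sum_(j < N) (cost (Z j) y a)%:E))%E).
    apply: ge0_le_integral => //.
    - by move=> a aI; rewrite lee_fin; apply: cost_ge0 => //; exact: LA.1.
    - by apply/measurable_EFinP; exact: measurable_cost LA.1.
    - apply: measurable_funeM; apply: emeasurable_sum => j.
      by apply/measurable_EFinP; exact: measurable_cost (LZ j).1.
    - move=> a /=; rewrite in_itv/= => /andP[a0 _].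
      by rewrite sumEFin -EFinM lee_fin; exact: cost_average.
  rewrite ge0_integralZl_EFin//; last 2 first.
  - by move=> a aI; rewrite sume_ge0// => j _; rewrite lee_fin cost_ge0//; exact: (LZ j).1.
  - apply: emeasurable_sum => j.
    by apply/measurable_EFinP; exact: measurable_cost (LZ j).1.
  rewrite ge0_integral_sum//.
  - by move=> j; apply/measurable_EFinP; exact: measurable_cost (LZ j).1.
  - by move=> j a aI; rewrite lee_fin cost_ge0//; exact: (LZ j).1.
have mU j : measurable_fun setT (fun w => Ufun mu (Z j) (X w)) by exact: measurable_Ufun (LZ j).1.
have U0 j y : (0 <= Ufun mu (Z j) y)%E by exact: Ufun_ge0 (LZ j).1.
apply: (@le_trans _ _ (\int[P]_w (N%:R^-1%:E * \sum_(j < N) Ufun mu (Z j) (X w)))%E).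
  apply: ge0_le_integral => //.
  - by move=> w _; exact: Ufun_ge0 LA.1.
  - exact: measurable_Ufun LA.1.
  - by apply: measurable_funeM; exact: emeasurable_sum.
rewrite ge0_integralZl_EFin//; last 2 first.
- by move=> w _; rewrite sume_ge0.
- exact: emeasurable_sum.
by rewrite ge0_integral_sum.
Qed.

End averaging.

(** * One dual variable for all stopping times *)

Section minimax.
Context (R : realType) (d : measure_display) (Omega : measurableType d).
Context (P : probability Omega R) (mu : probability (measurableTypeR R) R).
Context (T : R) (F : R -> set (set Omega)) (Y : R -> Omega -> R) (g : R -> R).
Hypotheses (T0 : 0 < T) (fF : filtration T F) (Y0 : nonneg_process T Y).
Hypotheses (aY : adapted T F Y) (rY : right_continuous_paths T Y).
Hypotheses (bY : bounded_paths T Y).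
Hypothesis atF : forall t, t \in `]0, T] -> atomless_on P (F t).
Hypotheses (dg : distortion g) (cg : concave_on01 g) (mg : is_mu_g g mu).
Hypothesis XY : Xspace P g (Ystar T Y).

Local Notation ST := (stopping_times T F).

Lemma Y_le_Ystar t w : t \in `[0, T] -> Y t w <= Ystar T Y w.
Proof.
move=> tI; apply: ub_le_sup; last by exists t.
by have [M HM] := bY w; exists M => _ [u uI <-]; exact: le_trans (ler_norm _) (HM _ uI).
Qed.

Lemma stopped_ge0 tau w : ST tau -> 0 <= stopped Y tau w.
Proof. by move=> [tI _]; exact: Y0. Qed.

Lemma stopped_le_Ystar tau w : ST tau -> stopped Y tau w <= Ystar T Y w.
Proof. by move=> [tI _]; exact: Y_le_Ystar. Qed.

Lemma Ystar_ge0 w : 0 <= Ystar T Y w.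
Proof.
have tI : 0 \in `[0, T] by rewrite in_itv/= lexx ltW.
by apply: le_trans (Y_le_Ystar w tI); exact: Y0.
Qed.

Lemma Ystar_measurable : measurable_fun setT (Ystar T Y).
Proof. by case: XY. Qed.

Lemma distorted_exp_Ystar : (distorted_exp P g (Ystar T Y) < +oo)%E.
Proof.
case: XY => _; congr (distorted_exp P g _ < _)%E; apply/funext => w.
by rewrite ger0_norm// Ystar_ge0.
Qed.

Let mS tau : ST tau -> measurable_fun setT (stopped Y tau).
Proof. exact: (stopped_measurable T0 fF aY rY). Qed.

Lemma distorted_exp_stopped_le tau : ST tau ->
  (distorted_exp P g (stopped Y tau) <= distorted_exp P g (Ystar T Y))%E.
Proof.
move=> st; rewrite (distorted_expE P dg cg mg (mS st)) (distorted_expE P dg cg mg Ystar_measurable).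
apply: le_level_int.
- by apply: mfun2_tmin; apply: tailfun_measurable; apply: surv_tailfun; exact: mS.
- by apply: mfun2_tmin; apply: tailfun_measurable; apply: surv_tailfun; exact: Ystar_measurable.
- by move=> a x /andP[a0 _] _; rewrite tmin_ge0//; apply: surv_ge0; exact: mS.
- move=> a x /andP[a0 _] _; apply: le_tmin => //.
  by apply: surv_le; [exact: mS|exact: Ystar_measurable|move=> w; exact: stopped_le_Ystar].
Qed.

Local Notation value := (ereal_sup [set distorted_exp P g (stopped Y tau) | tau in ST]).

(** The distorted expectation of $Y^*$ bounds the value from above; the constant time T excludes the
    supremum of an empty set. *)
Lemma value_fin : value \is a fin_num.
Proof.
have stT : ST (fun=> T) by apply: (stopping_time_cst fF); rewrite (ltW T0) lexx.
rewrite ge0_fin_numE.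
  apply: le_lt_trans distorted_exp_Ystar.
  by apply: ge_ereal_sup => _ [tau st <-]; exact: distorted_exp_stopped_le.
apply: (@le_trans _ _ (distorted_exp P g (stopped Y (fun=> T)))).
  rewrite (distorted_expE P dg cg mg); last exact: mS.
  by apply: level_int_ge0 => a x /andP[a0 _] _; rewrite tmin_ge0//; apply: surv_ge0; exact: mS.
by apply: ereal_sup_ubound; exists (fun=> T).
Qed.

(** The hard inequality of the exchange: [Z] is chosen before [tau]. *)
Lemma near_optimal_dual (e : R) : 0 < e ->
  exists2 Z, L1plus0 mu Z & forall tau, ST tau -> (EU P mu Y tau Z <= value + e%:E)%E.
Proof.
move=> e0.
pose v := fine value.
have valE : value = v%:E by rewrite /v fineK// value_fin.
pose sstar := surv P (Ystar T Y).
have tstar : tailfun sstar by apply: surv_tailfun; exact: Ystar_measurable.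
pose SS := [set surv P (stopped Y tau) | tau in ST].
have GwE : level_int mu (fun a x => tmin a (sstar x)) = distorted_exp P g (Ystar T Y).
  by rewrite (distorted_expE P dg cg mg)//; exact: Ystar_measurable.
have Gw0 : (0 <= level_int mu (fun a x => tmin a (sstar x)))%E.
  apply: level_int_ge0 => a x /andP[a0 _] x0; rewrite tmin_ge0//; have [+ _ _ _] := tstar; exact.
have Gwfin : level_int mu (fun a x => tmin a (sstar x)) \is a fin_num.
  by rewrite ge0_fin_numE// GwE distorted_exp_Ystar.
pose w := fine (level_int mu (fun a x => tmin a (sstar x))).
pose gk (n : nat) := level_int mu (fun a x => tmin a (n.+1%:R^-1 * sstar x)).
have gk0 : (gk n @[n --> \oo] --> 0)%E.
  by apply: level_int_tmin_scale_cvg0 => //; rewrite GwE distorted_exp_Ystar.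
have /fine_cvgP[gkfin gkr] := gk0.
have lim1 : (1 + n.+1%:R^-1) * (v + (fine \o gk) n) @[n --> \oo] --> (1 + 0) * (v + 0).
  by apply: cvgM; apply: cvgD => //; try exact: cvg_cst; exact: cvg_harmonic.
rewrite addr0 mul1r addr0 in lim1.
have e20 : 0 < e / 2 by lra.
(* The scale k = 1 / (n + 1) is fixed by the leading term alone. *)
have [n [gn gnv]] : exists n, gk n \is a fin_num /\
    (1 + n.+1%:R^-1) * (v + fine (gk n)) <= v + e / 2.
  near \oo => n; exists n; split; first by near: n.
  near: n; move/cvgrPdist_lt : lim1 => /(_ _ e20); apply: filterS => n.
  rewrite /= ltr_norml => /andP[+ _].
  by move: (_ * (v + _)) => z; lra.
pose k : R := n.+1%:R^-1.
have k0 : 0 < k by rewrite invr_gt0.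
have k1 : k <= 1 by rewrite invf_le1 ?ltr0Sn// ler1n.
pose c := 1 + 4 * ((1 + k) / k) * w.
(* [c] depends on [k] and [w] but not on [N], so [c / N] can be brought below e / 2. *)
pose N := (Num.truncn (c / (e / 2))).+1.
have cN : c <= N%:R * (e / 2) by rewrite -ler_pdivrMr// ltW// truncnS_gt.
have SS0 : SS !=set0.
  exists (surv P (stopped Y (fun=> T))); exists (fun=> T) => //.
  by apply: (stopping_time_cst fF); rewrite (ltW T0) lexx.
have SStail s : SS s -> tailfun s.
  by move=> [tau st <-]; apply: surv_tailfun; exact: mS.
have SSle1 s x : SS s -> s x <= 1 by move=> [tau st <-]; exact: surv_le1.
have SSstar s x : SS s -> s x <= sstar x.
  move=> [tau st <-]; apply: surv_le; [exact: mS|exact: Ystar_measurable|].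
  by move=> u; exact: stopped_le_Ystar.
have Gv s : SS s -> (level_int mu (fun a x => tmin a (s x)) <= v%:E)%E.
  move=> [tau st <-]; rewrite -(distorted_expE P dg cg mg (mS st)) -valE.
  by apply: ereal_sup_ubound; exists tau.
have Gw : (level_int mu (fun a x => tmin a (sstar x)) <= w%:E)%E by rewrite /w fineK.
have k01 : 0 < k <= 1 by rewrite k0 k1.
have Ggk : (level_int mu (fun a x => tmin a (k * sstar x)) <= (fine (gk n))%:E)%E.
  by rewrite (fineK gn).
have [|Z [LZ HZ]] := @minimax_levels R mu SS sstar SS0 tstar SStail SSle1 SSstar
    _ v w Gv Gw N k (fine (gk n)) k01 Ggk.
  move=> N' q t b M q0 t01 tb HM _ _ [t1 s1 <-] [t2 s2 <-].
  apply: (multi_tmin_mixture T0 fF aY rY atF q0 t01 tb) => // tau st.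
  by apply: HM; exists tau.
(* Padding beyond [N], as the averaging lemmas ask for membership at every index. *)
pose Z' j := if (j < N)%N then Z j else Z 0%N.
have LZ' j : L1plus0 mu (Z' j) by rewrite /Z'; case: ifP => jN; apply: LZ.
exists (average N Z'); first exact: L1plus0_average.
move=> tau st; apply: (le_trans (@integral_Ufun_average _ _ _ P mu N Z' _ isT LZ' (mS st))).
have N0 : 0 < N%:R :> R by rewrite ltr0n.
have -> : (\sum_(j < N) \int[P]_w0 Ufun mu (Z' j) (stopped Y tau w0) =
    \sum_(j < N) level_int mu (lev (Z j) (surv P (stopped Y tau))))%E.
  apply: eq_bigr => j _; rewrite (integral_Ufun P (mS st) (fun u => stopped_ge0 u st) (LZ' j).1).
  by rewrite /Z' ltn_ord.
have H : (\sum_(j < N) level_int mu (lev (Z j) (surv P (stopped Y tau))) <=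
    (N%:R * (1 + k) * (v + fine (gk n)) + c)%:E)%E by apply: HZ; exists tau.
apply: (@le_trans _ _ (N%:R^-1%:E * (N%:R * (1 + k) * (v + fine (gk n)) + c)%:E)%E).
  by apply: lee_wpmul2l => //; rewrite lee_fin invr_ge0 ltW.
rewrite valE -EFinM -EFinD lee_fin ler_pdivrMl// -mulrA.
have : N%:R * ((1 + k) * (v + fine (gk n))) <= N%:R * (v + e / 2) by rewrite ler_pM2l.
lra.
Unshelve. all: by end_near. Qed.

End minimax.
(** * Dense families of dual variables *)

Section approximating_duals.
Context (R : realType) (d : measure_display) (Omega : measurableType d).
Context (P : probability Omega R) (mu : probability (measurableTypeR R) R).

Local Notation I1 := (`]0, 1]%classic : set R).
Local Notation DP := (setT `*` (I1 : set (measurableTypeR R)) : set (Omega * measurableTypeR R)).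

Let mI1 : measurable (I1 : set (measurableTypeR R)).
Proof. exact: measurable_itv. Qed.

Let mDP : measurable DP.
Proof. exact: measurableX. Qed.

Let DPP (z : Omega * measurableTypeR R) : DP z -> z.2 \in `]0, 1].
Proof. by case: z => w a [_]. Qed.

Let msnd (h : R -> R) : measurable_fun (I1 : set (measurableTypeR R)) h ->
  measurable_fun DP (fun z : Omega * measurableTypeR R => (h z.2)%:E).
Proof.
move=> mh; apply/measurable_EFinP; apply: (measurable_comp (F := I1)) mh _ => //.
  by move=> _ [[a x] /= [_ +] <-].
by apply: measurable_funS measurable_snd.
Qed.

Lemma integral_product_snd (h : R -> R) :
  measurable_fun (I1 : set (measurableTypeR R)) h ->
  (forall a, a \in `]0, 1] -> 0 <= h a) ->
  (\int[P \x mu]_(z in DP) (h z.2)%:E = \int[mu]_(a in `]0%R, 1%R]) (h a)%:E)%E.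
Proof.
move=> mh h0.
rewrite (@fubini_rectangle2 _ _ _ _ R P mu setT I1 (fun z => (h z.2)%:E))//.
- apply: eq_integral => a _; rewrite /= integral_cst//.
  by rewrite [X in (_ * X)%E](_ : _ = 1%E) ?mule1//; exact: probability_setT.
- exact: msnd.
- by move=> w a _ aI; rewrite lee_fin h0.
Qed.

Lemma integral_product_cost (X : Omega -> R) Z : measurable_fun setT X -> L1plus mu Z ->
  (\int[P]_w Ufun mu Z (X w) = \int[P \x mu]_(z in DP) (cost Z (X z.1) z.2)%:E)%E.
Proof.
move=> mX LZ.
rewrite (@fubini_rectangle1 _ _ _ _ R P mu setT I1 (fun z => (cost Z (X z.1) z.2)%:E))//.
- apply/measurable_EFinP; apply: measurable_Ufun_integrand => //.
  exact: L1plus_measurable LZ.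
- by move=> w a _ aI; rewrite lee_fin; exact: cost_ge0 LZ aI.
Qed.

Lemma L1plus_fin (Z : R -> R) : L1plus mu Z ->
  (\int[mu]_(a in `]0%R, 1%R]) (Z a)%:E < +oo)%E.
Proof.
move=> [/integrableP[_ +] Z0]; apply: le_lt_trans; rewrite le_eqVlt; apply/orP; left.
by apply/eqP; apply: eq_integral => a; rewrite inE => aI /=; rewrite ger0_norm// Z0.
Qed.

Lemma Lstar_sub (D : set (R -> R)) Zo : D `<=` L1plus0 mu -> L1plus0 mu Zo ->
  Lstar D Zo `<=` L1plus0 mu.
Proof.
move=> DL [[iZo Zo0] Zo1] _ [Z [a [DZ aI ->]]].
have [[iZ Z0] Z1] := DL _ DZ; move: aI; rewrite in_itv/= => /andP[a0 a1].
split; last first.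
  by rewrite Zo1 mulr0 add0r.
split; last first.
  by move=> x xI; rewrite addr_ge0 ?Z0// mulr_ge0 ?Zo0.
have m1 : measurable_fun (I1 : set (measurableTypeR R)) (\1_(`]0, a] : set R) : R -> R).
  exact: measurable_indic.
have mZo : measurable_fun (I1 : set (measurableTypeR R)) Zo by exact: (@L1plus_measurable _ mu).
rewrite (_ : _ \o _ = (fun x => ((\1_(`]0, a] : set R) x * Zo x)%:E + (Z x)%:E)%E)); last first.
  by apply/funext => x /=; rewrite EFinD.
apply: integrableD => //.
apply: (le_integrable _ _ _ iZo) => //.
- by apply/measurable_EFinP; exact: measurable_funM.
- move=> x xI; rewrite /= lee_fin normrM ler_piMl// indicE; case: (_ \in _) => /=.
    by rewrite normr1.
  by rewrite normr0.
Qed.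

Context (Ys : Omega -> R).
Hypotheses (mYs : measurable_fun setT Ys).

(** On ]0, a] the variable [W] is at least [Zo], and its cost is dominated by the integrable [f] up
    to |Z - V|; on ]a, 1] the weight is at most 1/a, so closeness of [V] to [Z] in $L^1$ controls
    the cost. [X] enters only through [X <= Ys], hence one [W] serves all of them. *)
Lemma Lstar_approx (ZZ : set (R -> R)) Zo Z (e : R) :
  L1dense mu ZZ (L1plus0 mu) -> L1plus0 mu Zo ->
  (\int[P]_w \int[mu]_(a in `]0%R, 1%R])
        (Num.max (Ys w - Zo a) 0 / (a : R))%:E < +oo)%E ->
  L1plus0 mu Z -> 0 < e ->
  exists2 W, Lstar ZZ Zo W & forall X : Omega -> R, measurable_fun setT X ->
    (forall w, X w <= Ys w) ->
    (\int[P]_w Ufun mu W (X w) <= \int[P]_w Ufun mu Z (X w) + e%:E)%E.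
Proof.
move=> [ZZL dZZ] LZo fZo LZ e0.
have [[iZo Zo0] Zo1] := LZo; have [[iZ Z0] Z1] := LZ.
have mZo := L1plus_measurable LZo.1; have mZ := L1plus_measurable LZ.1.
(* [Z] is added because the linear term of the cost of [W] near 0 is Zo + V, and V <= Z + |Z -
   V|. *)
pose f (z : Omega * measurableTypeR R) : R := cost Zo (Ys z.1) z.2 + Z z.2.
have f0 z : DP z -> 0 <= f z.
  by move=> /DPP zI; rewrite addr_ge0 ?Z0//; exact: cost_ge0 LZo.1 zI.
have mcost : measurable_fun DP (fun z : Omega * measurableTypeR R => cost Zo (Ys z.1) z.2).
  exact: measurable_Ufun_integrand.
have mZs := msnd mZ.
have mf : measurable_fun DP f.
  by apply: measurable_funD => //; apply/measurable_EFinP.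
have mmax : measurable_fun DP (fun z : Omega * measurableTypeR R =>
    (Num.max (Ys z.1 - Zo z.2) 0 / z.2)%:E).
  by apply/measurable_EFinP; exact: measurable_excess.
have max0 z : DP z -> 0 <= Num.max (Ys z.1 - Zo z.2) 0 / z.2.
  move=> /DPP; rewrite in_itv/= => /andP[a0 _].
  by rewrite divr_ge0 ?(ltW a0)// le_max lexx orbT.
have ffin : (\int[P \x mu]_(z in DP) (f z)%:E < +oo)%E.
  rewrite /f /cost; under eq_integral do rewrite !EFinD.
  rewrite ge0_integralD//; last 3 first.
  - move=> z Dz; rewrite -EFinD lee_fin addr_ge0 ?max0// Zo0//; exact: DPP.
  - by apply: emeasurable_funD => //; exact: msnd.
  - by move=> z /DPP zI; rewrite lee_fin Z0.
  rewrite ge0_integralD//; last 2 first.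
  - by move=> z /DPP zI; rewrite lee_fin Zo0.
  - exact: msnd.
  rewrite !integral_product_snd//.
  apply: lte_add_pinfty; last exact: L1plus_fin LZ.1.
  apply: lte_add_pinfty; last exact: L1plus_fin LZo.1.
  rewrite (@fubini_rectangle1 _ _ _ _ R P mu setT I1
    (fun z => (Num.max (Ys z.1 - Zo z.2) 0 / z.2)%:E))//.
  by move=> w a _ aI; rewrite lee_fin (max0 (w, a)).
have intf : (P \x mu)%E.-integrable DP (EFin \o f).
  apply/integrableP; split; first exact/measurable_EFinP.
  apply: le_lt_trans ffin; rewrite le_eqVlt; apply/orP; left; apply/eqP.
  by apply: eq_integral => z; rewrite inE => Dz; rewrite /= ger0_norm// f0.
(* n + 2 keeps the cut strictly below 1, as [Lstar] requires. *)
pose an (n : nat) : R := n.+2%:R^-1.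
have an0 n : 0 < an n by rewrite invr_gt0.
have an1 n : an n < 1 by rewrite invf_lt1 ?ltr0Sn// ltr1n.
pose fn n (z : Omega * measurableTypeR R) : R := if z.2 <= an n then f z else 0.
have fn0 n z : DP z -> 0 <= fn n z.
  by move=> Dz; rewrite /fn; case: ifP => // _; exact: f0.
have mfn n : measurable_fun DP (fn n).
  apply: measurable_fun_if => //.
  - apply: measurable_fun_ler; last exact: measurable_cst.
    exact: (proj1 (measurable_EFinP _ _) (msnd (@measurable_id _ _ _))).
  - by apply: measurable_funS mf => // z [].
have cvgD : (\int[P \x mu]_(z in DP) (fn n z)%:E @[n --> \oo] --> 0)%E.
  rewrite -(integral0 (P \x mu)%E DP).
  apply: (dominated_cvg mDP (g := EFin \o f)) => //.
  - by move=> n; apply/measurable_EFinP; exact: mfn.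
  - move=> z /DPP; rewrite in_itv/= => /andP[z0 _].
    have c0 : n.+1%:R^-1 @[n --> \oo] --> (0 : R) by exact: cvg_harmonic.
    apply: cvg_near_cst; near=> n; rewrite /fn.
    suff -> : z.2 <= an n = false by [].
    apply/negbTE; rewrite -ltNge /an.
    apply: (@le_lt_trans _ _ n.+1%:R^-1).
      by rewrite lef_pV2 ?posrE// ler_nat.
    near: n; move/cvgrPdist_lt : c0 => /(_ _ z0); apply: filterS => n.
    by rewrite sub0r normrN => /ltr_normlW.
  - move=> n z Dz; rewrite /= lee_fin ger0_norm ?fn0// /fn.
    by case: ifP => // _; exact: f0.
have e20 : 0 < e / 2 by lra.
have [n Dn] : exists n, (\int[P \x mu]_(z in DP) (fn n z)%:E <= (e / 2)%:E)%E.
  have /fine_cvgP[finD cvD] := cvgD.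
  have cvD' : \forall n \near \oo, fine (\int[P \x mu]_(z in DP) (fn n z)%:E)%E <= e / 2.
    move/cvgrPdist_lt : cvD => /(_ _ e20); apply: filterS => n.
    by rewrite sub0r normrN => /ltr_normlW/ltW.
  near \oo => n; exists n.
  have fD : (\int[P \x mu]_(z in DP) (fn n z)%:E)%E \is a fin_num by near: n.
  by rewrite -(fineK fD) lee_fin; near: n.
set a := an n in Dn.
have a0 : 0 < a by exact: an0.
(* On ]a, 1] the difference |Z - V| enters once through the excess, with weight at most 1/a, and
   once through the linear term. *)
pose c := a^-1 + 1.
have c0 : 0 < c by rewrite /c addr_gt0// invr_gt0.
have ec0 : 0 < e / 2 / c by rewrite divr_gt0.
have [V ZV dV] := dZZ _ LZ _ ec0.
have LV := ZZL _ ZV; have [[iV V0] V1] := LV.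
have mV := L1plus_measurable LV.1.
pose W := fun x => \1_(`]0, a] : set R) x * Zo x + V x.
have LW : Lstar ZZ Zo W by exists V, a; split => //; rewrite in_itv/= a0/=; exact: an1.
exists W => // X mX XY.
have LW0 : L1plus0 mu W by apply: (Lstar_sub ZZL LZo).
rewrite integral_product_cost//; last exact: LW0.1.
rewrite (integral_product_cost mX LZ.1).
pose dd x := `|Z x - V x|.
have mdd : measurable_fun (I1 : set (measurableTypeR R)) (fun x => c * dd x).
  apply: measurable_funM; first exact: measurable_cst.
  by apply: measurableT_comp => //; exact: measurable_funB.
have mcZ : measurable_fun DP (fun z : Omega * measurableTypeR R => (cost Z (X z.1) z.2)%:E).
  by apply/measurable_EFinP; exact: measurable_Ufun_integrand.
have cZ0 z : DP z -> (0 <= (cost Z (X z.1) z.2)%:E)%E.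
  by move=> /DPP zI; rewrite lee_fin; exact: cost_ge0 LZ.1 zI.
have mfne : measurable_fun DP (fun z => (fn n z)%:E) by apply/measurable_EFinP; exact: mfn.
have fne0 z : DP z -> (0 <= (fn n z)%:E)%E by move=> Dz; rewrite lee_fin fn0.
have cdd0 x : 0 <= c * dd x by apply: mulr_ge0; [exact: ltW|exact: normr_ge0].
apply: (@le_trans _ _ (\int[P \x mu]_(z in DP)
    ((cost Z (X z.1) z.2)%:E + ((fn n z)%:E + (c * dd z.2)%:E)))%E).
  apply: ge0_le_integral => //.
  - by move=> z /DPP zI; rewrite lee_fin; exact: cost_ge0 LW0.1 zI.
  - apply/measurable_EFinP; apply: measurable_Ufun_integrand => //.
    exact: L1plus_measurable LW0.1.
  - apply: emeasurable_funD => //; apply: emeasurable_funD => //; exact: (msnd mdd).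
  - move=> z Dz; have zI := DPP Dz; move: (zI); rewrite in_itv/= => /andP[z0 z1].
    have cz := cZ0 z Dz; rewrite lee_fin in cz.
    have dd1 : V z.2 - Z z.2 <= dd z.2 by rewrite /dd distrC ler_norm.
    have dd2 : Z z.2 - V z.2 <= dd z.2 by rewrite /dd ler_norm.
    have dd0 : 0 <= dd z.2 by exact: normr_ge0.
    have Vz := V0 _ zI; have XYz := XY z.1.
    have ai0 : 0 < a^-1 by rewrite invr_gt0.
    have cd : c * dd z.2 = a^-1 * dd z.2 + dd z.2 by rewrite /c; lra.
    have ad0 : 0 <= a^-1 * dd z.2 by apply: mulr_ge0 => //; exact: ltW.
    rewrite -!EFinD lee_fin cd /fn /f /cost /W indicE mem_setE in_itv/= z0/=.
    have [za|az] := leP z.2 a.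
      rewrite /= mul1r.
      have : Num.max (X z.1 - (Zo z.2 + V z.2)) 0 / z.2 <= Num.max (Ys z.1 - Zo z.2) 0 / z.2.
        rewrite ler_pM2r ?invr_gt0// ge_max !le_max lexx orbT andbT; apply/orP; left; lra.
      by move: cz; rewrite /cost; lra.
    rewrite /= mul0r !add0r.
    have h1 : Num.max (X z.1 - V z.2) 0 / z.2 <= Num.max (X z.1 - Z z.2) 0 / z.2 + dd z.2 / z.2.
      rewrite -mulrDl ler_pM2r ?invr_gt0// ge_max; apply/andP; split.
        have : X z.1 - Z z.2 <= Num.max (X z.1 - Z z.2) 0 by rewrite le_max lexx.
        by lra.
      by rewrite addr_ge0// le_max lexx orbT.
    have h2 : dd z.2 / z.2 <= a^-1 * dd z.2.
      by rewrite mulrC ler_wpM2r// lef_pV2 ?posrE// ltW.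
    by lra.
rewrite ge0_integralD//; last 2 first.
- by move=> z Dz; apply: adde_ge0; [exact: fne0|rewrite lee_fin].
- by apply: emeasurable_funD => //; exact: (msnd mdd).
apply: leeD => //.
rewrite ge0_integralD//; last 2 first.
- by move=> z Dz; rewrite lee_fin.
- exact: (msnd mdd).
rewrite (_ : e = e / 2 + e / 2); last by lra.
rewrite EFinD; apply: leeD => //.
rewrite (@integral_product_snd (fun x => c * dd x))//.
under eq_integral do rewrite EFinM.
rewrite ge0_integralZl_EFin//; last 3 first.
- by move=> x _; rewrite lee_fin; exact: normr_ge0.
- by apply/measurable_EFinP; apply: measurableT_comp => //; exact: measurable_funB.
- exact: ltW.
apply: (@le_trans _ _ (c%:E * (e / 2 / c)%:E)%E).
  by apply: lee_wpmul2l; [rewrite lee_fin ltW|exact: ltW].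
by rewrite -EFinM lee_fin mulrC divfK// gt_eqF.
Unshelve. all: by end_near. Qed.

End approximating_duals.

(** * The quantile function of $Y^*$ near 0 *)

Section quantile_dual.
Context (R : realType) (d : measure_display) (Omega : measurableType d).
Context (P : probability Omega R) (mu : probability (measurableTypeR R) R).
Context (T : R) (Y : R -> Omega -> R) (g : R -> R).
Hypotheses (dg : distortion g) (cg : concave_on01 g) (mg : is_mu_g g mu).
Hypothesis mYs : measurable_fun setT (Ystar T Y).
Hypothesis Ys0 : forall w, 0 <= Ystar T Y w.
Hypothesis fin : (distorted_exp P g (Ystar T Y) < +oo)%E.

Local Notation I1 := (`]0, 1]%classic : set R).

Let Zq := tail_quantile (surv P (Ystar T Y)).

(** The infimum in [quantile] runs over all reals; for a < 1 no negative level qualifies, since the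
    survival function is 1 there. *)
Lemma ZstarE a : a \in `]0, 1] -> Zstar P T Y a = Zq a.
Proof.
rewrite in_itv/= => /andP[a0 a1]; rewrite /Zstar /Zq /tail_quantile.
case: eqVneq => // an1; congr inf; apply/seteqP; split => x /=.
  move=> h; have xs : surv P (Ystar T Y) x <= a by rewrite /surv; lra.
  split => //; rewrite leNgt; apply/negP => x0.
  move: xs; rewrite surv_lt0// => a1'.
  by move: an1; rewrite eq_le a1 a1'.
by move=> [x0]; rewrite /surv; lra.
Qed.

(** The excess is part of the cost of the dual minimizer for $Y^*$, whose expectation is the finite
    distorted expectation of $Y^*$. *)
Lemma Zstar_L1Y : L1Y P T Y mu (Zstar P T Y).
Proof.
have [LZ e] := dual_attained dg cg mg mYs Ys0 fin.
rewrite -/Zq in LZ e.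
have LZs : L1plus0 mu (Zstar P T Y).
  split; last by rewrite /Zstar eqxx.
  split; last by move=> a aI; rewrite ZstarE//; exact: LZ.1.2.
  apply: (@eq_integrable _ _ _ mu I1 (measurable_itv _) (EFin \o Zq)); last exact: LZ.1.1.
  by move=> a; rewrite inE => aI /=; rewrite ZstarE.
split => //.
have mI1 : measurable (I1 : set (measurableTypeR R)) by exact: measurable_itv.
apply: le_lt_trans fin; rewrite -e.
have h w : (\int[mu]_(a in `]0%R, 1%R]) (Num.max (Ystar T Y w - Zstar P T Y a) 0 / a)%:E <=
  Ufun mu Zq (Ystar T Y w))%E.
  apply: ge0_le_integral => //.
  - move=> a /=; rewrite in_itv/= => /andP[a0 _].
    by rewrite lee_fin divr_ge0 ?(ltW a0)// le_max lexx orbT.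
  - apply/measurable_EFinP; apply: measurable_funM; last exact: measurable_inv_itv01.
    apply: measurable_maxr; last exact: measurable_cst.
    apply: measurable_funB; first exact: measurable_cst.
    exact: L1plus_measurable LZs.1.
  - by apply/measurable_EFinP; exact: (measurable_cost (Ystar T Y w) LZ.1).
  - move=> a aI; rewrite lee_fin ZstarE//; rewrite lerDl; exact: LZ.1.2.
apply: ge0_le_integral => //.
- move=> w _; apply: integral_ge0 => a /=; rewrite in_itv/= => /andP[a0 _].
  by rewrite lee_fin divr_ge0 ?(ltW a0)// le_max lexx orbT.
- apply: (@measurable_integral_section1 _ _ _ _ R mu setT I1
    (fun z : Omega * measurableTypeR R =>
      (Num.max (Ystar T Y z.1 - Zstar P T Y z.2) 0 / z.2)%:E)) => //.
    apply/measurable_EFinP; apply: measurable_excess => //.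
    exact: L1plus_measurable LZs.1.
  move=> w a _ /=; rewrite in_itv/= => /andP[a0 _].
  by rewrite lee_fin divr_ge0 ?(ltW a0)// le_max lexx orbT.
- exact: measurable_Ufun LZ.1.
Qed.

End quantile_dual.
Theorem theorem2p2 (R : realType) (d : measure_display)
    (Omega : measurableType d) (P : probability Omega R)
    (T : R) (F : R -> set (set Omega)) (Y : R -> Omega -> R)
    (g : R -> R) (mu : probability (measurableTypeR R) R)
    (ZZ : set (R -> R)) :
  0 < T ->
  atomless_on P measurable ->
  filtration T F ->
  right_continuous_filtration T F ->
  trivial_at0 P F ->
  nonneg_process T Y ->
  adapted T F Y ->
  right_continuous_paths T Y ->
  bounded_paths T Y ->
  (forall t, t \in `]0, T] -> atomless_on P (F t) /\ countably_generated (F t)) ->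
  distortion g ->
  {within `[0, 1], continuous g} ->
  concave_on01 g ->
  is_mu_g g mu ->
  L1dense mu ZZ (L1plus0 mu) ->
  Xspace P g (Ystar T Y) ->
  let supinf :=
    ereal_sup [set ereal_inf [set EU P mu Y tau Z | Z in L1plus0 mu]
              | tau in stopping_times T F] in
  let infsup (A : set (R -> R)) :=
    ereal_inf [set ereal_sup [set EU P mu Y tau Z | tau in stopping_times T F]
              | Z in A] in
  (forall Zo, L1Y P T Y mu Zo ->
    [/\ ereal_sup [set distorted_exp P g (stopped Y tau)
                  | tau in stopping_times T F] = supinf,
        supinf = infsup (L1plus0 mu)
      & infsup (L1plus0 mu) = infsup (Lstar ZZ Zo)]) /\
  L1Y P T Y mu (Zstar P T Y).
Proof.
move=> T0 _ fF _ _ Y0 aY rY bY acF dg _ cg mg dZZ XY supinf infsup.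
have atF t : t \in `]0, T] -> atomless_on P (F t) by move=> /acF[].
have mS tau : stopping_times T F tau -> measurable_fun setT (stopped Y tau).
  exact: (stopped_measurable T0 fF aY rY).
have S0 tau w : stopping_times T F tau -> 0 <= stopped Y tau w.
  exact: stopped_ge0.
have mYs := Ystar_measurable XY.
have Ys0 := Ystar_ge0 T0 Y0 bY.
have fYs := distorted_exp_Ystar T0 Y0 bY XY.
have fS tau : stopping_times T F tau -> (distorted_exp P g (stopped Y tau) < +oo)%E.
  move=> st; apply: le_lt_trans fYs.
  exact: (distorted_exp_stopped_le T0 fF aY rY bY dg cg mg XY st).
split; last exact: (Zstar_L1Y dg cg mg mYs Ys0 fYs).
move=> Zo [LZo fZo].
(* The inner infimum is evaluated for each stopping time separately. *)
have valueE : ereal_sup [set distorted_exp P g (stopped Y tau)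
    | tau in stopping_times T F] = supinf.
  rewrite /supinf; congr ereal_sup; apply/seteqP.
  have e tau : stopping_times T F tau -> distorted_exp P g (stopped Y tau) =
      ereal_inf [set EU P mu Y tau Z | Z in L1plus0 mu].
    by move=> st; apply: (dual_inf dg cg mg (mS _ st)) => [w|]; [exact: S0|exact: fS].
  by split => _ [tau st <-]; exists tau => //; rewrite e.
split => //.
(* Weak duality gives one inequality; the other needs, for every e > 0, a dual variable within e of
   the value. *)
- apply/eqP; rewrite eq_le; apply/andP; split.
    apply: ge_ereal_sup => _ [tau st <-]; apply: le_ereal_inf_tmp => _ [Z LZ <-].
    apply: (@le_trans _ _ (EU P mu Y tau Z)).
      by apply: ereal_inf_lbound; exists Z.
    by apply: ereal_sup_ubound; exists tau.
  rewrite -valueE; apply/lee_addgt0Pr => e e0.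
  have [Z LZ HZ] := near_optimal_dual T0 fF Y0 aY rY bY atF dg cg mg XY e0.
  apply: ge_ereal_inf; exists (ereal_sup [set EU P mu Y tau Z | tau in stopping_times T F]).
    by exists Z.
  by apply: ge_ereal_sup => _ [tau st <-]; exact: HZ.
(* Every [Z] is matched up to e by a member of [Lstar], uniformly in the stopping time because all
   stopped values lie below $Y^*$. *)
- apply/eqP; rewrite eq_le; apply/andP; split.
    apply: ereal_inf_le_tmp => _ [W LW <-]; exists W => //.
    exact: (Lstar_sub dZZ.1 LZo).
  apply: le_ereal_inf_tmp => _ [Z LZ <-]; apply/lee_addgt0Pr => e e0.
  have [W LW HW] := Lstar_approx mYs dZZ LZo fZo LZ e0.
  apply: ge_ereal_inf; exists (ereal_sup [set EU P mu Y tau W | tau in stopping_times T F]).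
    by exists W.
  apply: ge_ereal_sup => _ [tau st <-].
  have le1 w : stopped Y tau w <= Ystar T Y w by exact: (stopped_le_Ystar bY w st).
  apply: (le_trans (HW _ (mS _ st) le1)); apply: leeD => //.
  by apply: ereal_sup_ubound; exists tau.
Qed.
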